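(* Let $D\subset\subset\mathbb{C}^{n}$ be a relatively compact open set containing the origin, with coordinates $z=(z_{1},\dots,z_{n})$, and let $\varphi$ be a plurisubharmonic function on $D$. Then for every $k\in\mathbb{N}$ there exists a plurisubharmonic function $\varphi_{k}$ on an open neighborhood of $D\times\{o\}$ in $\mathbb{C}^{n}\times\mathbb{C}^{(2^{k}-1)n}$ (with coordinates $(z,w)$), where $o$ denotes the origin of $\mathbb{C}^{(2^{k}-1)n}$, such that for every $z\in D$: (1) $\varphi_{k}(z,o)=\varphi(z)$; (2) $\nu(\varphi_{k},(z,o))=\nu(\varphi,z)$; (3) $\displaystyle \frac{(2^{k}-1)n}{\nu(\varphi,z)}\leq c_{(z,o)}(\varphi_{k})\leq \frac{2^{k}n}{\nu(\varphi,z)}$.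
   Context: $\mathbb{N}=\{1,2,\dots\}$. Plurisubharmonic functions take values in $[-\infty,+\infty)$ and, by convention, are not identically $-\infty$ on any connected component of their domain. Lelong number: for a plurisubharmonic function $\psi$ near a point $x\in\mathbb{C}^{N}$, $\nu(\psi,x):=\sup\{c\geq 0:\ \psi(y)\leq c\log|y-x|+O(1)\text{ as } y\to x\}$. Complex singularity exponent: for such $\psi$, $c_{x}(\psi):=\sup\{c\geq 0:\ \mathcal{I}(c\psi)_{x}=\mathcal{O}_{x}\}$, where $\mathcal{O}_x$ is the ring of germs of holomorphic functions at $x$ and $\mathcal{I}(\psi)$ is the multiplier ideal sheaf, i.e. the sheaf of germs of holomorphic functions $f$ such that $|f|^{2}e^{-2\psi}$ is locally integrable with respect to Lebesgue measure. Thus $c_x(\psi)$ is the supremum of the $c\ge 0$ such that $e^{-2c\psi}$ is integrable on some neighborhood of $x$. When $\nu(\varphi,z)=0$, the quotients in (3) are interpreted as $+\infty$. *)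

(* Defs.v *)
From HB Require Import structures.
From mathcomp Require Import all_boot all_order all_algebra complex.
From mathcomp Require Import all_classical all_reals all_analysis.

Set Implicit Arguments.
Unset Strict Implicit.
Unset Printing Implicit Defensive.

Import Order.TTheory GRing.Theory Num.Theory numFieldNormedType.Exports.

Local Open Scope classical_set_scope.
Local Open Scope ring_scope.
Local Open Scope complex_scope.

(* [R[i]] itself carries no topology in MathComp-Analysis; its regular module
   [R[i]^o] does, and it makes the row vectors a normed module over [R[i]]. *)
Notation Cspace R N := 'rV[(R[i])^o]_N.

(* MathComp-Analysis infers that a product of measures is sigma-finite only for
   subprobabilities. *)
Lemma product_sigma_finite (d1 d2 : measure_display) (T1 : measurableType d1)
    (T2 : measurableType d2) (R : realType)
    (m1 : {sigma_finite_measure set T1 -> \bar R})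
    (m2 : {sigma_finite_measure set T2 -> \bar R}) :
  sigma_finite setT (m1 \x m2)%E.
Proof.
have /sigma_finiteP[F [TF ndF Foo]] := sigma_finiteT m1.
have /sigma_finiteP[G [TG ndG Goo]] := sigma_finiteT m2.
exists (fun n => F n `*` G n).
  rewrite -setXTT TF TG predeqE => -[x y]; split.
    move=> [/= [n _ Fnx] [k _ Gky]]; exists (maxn n k) => //; split.
    - by move: x Fnx; exact/subsetPset/ndF/leq_maxl.
    - by move: y Gky; exact/subsetPset/ndG/leq_maxr.
  by move=> [n _ []/= ? ?]; split; exists n.
move=> k; have [? ?] := Foo k; have [? ?] := Goo k.
split; first exact: measurableX.
by rewrite product_measure1E// lte_mul_pinfty// ge0_fin_numE.
Qed.

Section tuple_measure.
Local Open Scope ereal_scope.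
Context (d : measure_display) (T : measurableType d) (R : realType).
Variable mu : {sigma_finite_measure set T -> \bar R}.

(* The N-fold product of mu with itself, on the product sigma-algebra. *)
Fixpoint tuple_measure (N : nat) : set (N.-tuple T) -> \bar R :=
  match N with
  | 0 => dirac [tuple]
  | N'.+1 => pushforward (mu \x tuple_measure (N := N'))
               (fun p : T * N'.-tuple T => [tuple of p.1 :: p.2])
  end.

Lemma tuple_measure_sigma_finite (N : nat) :
  exists m : {sigma_finite_measure set (N.-tuple T) -> \bar R},
    tuple_measure (N := N) = m :> (set (N.-tuple T) -> \bar R).
Proof.
elim: N => [|N [m /= ->]]; first by exists (dirac [tuple]).
set f := (fun p : T * N.-tuple T => [tuple of p.1 :: p.2]).
have mf : measurable_fun setT f by exact: measurable_cons.
pose g (t : N.+1.-tuple T) : T * N.-tuple T := (thead t, [tuple of behead t]).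
have mg : measurable_fun setT g.
  apply/measurable_fun_pairP; split; last exact: measurable_behead.
  exact: measurable_tnth.
have fK : cancel f g by move=> [x t]; congr pair; apply/val_inj.
pose nu := measure_function_pushforward__canonical__measure_function_Measure
  (mu \x m) mf.
have sf : sigma_finite setT nu.
  have [F FT Ffin] := product_sigma_finite mu m.
  exists (fun i => g @^-1` F i).
    by rewrite -preimage_bigcup -FT preimage_setT.
  move=> i; have [mFi Fi] := Ffin i; split.
    by rewrite -[X in measurable X]setTI; exact: mg.
  rewrite /= /pushforward -comp_preimage.
  by rewrite (_ : g \o f = id) //; apply/funext => p /=; rewrite fK.
by exists (HB.pack_for {sigma_finite_measure set (N.+1.-tuple T) -> \bar R}
  (Measure.sort nu) (Measure_isSigmaFinite.Build _ _ _ nu sf)).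
Qed.

Let tuple_measure0 N : tuple_measure (N := N) set0 = 0.
Proof. by have [m ->] := tuple_measure_sigma_finite N; exact: measure0. Qed.

Let tuple_measure_ge0 N A : 0 <= tuple_measure (N := N) A.
Proof. by have [m ->] := tuple_measure_sigma_finite N; exact: measure_ge0. Qed.

Let tuple_measure_sigma_additive N :
  semi_sigma_additive (tuple_measure (N := N)).
Proof.
have [m ->] := tuple_measure_sigma_finite N.
exact: measure_semi_sigma_additive.
Qed.

HB.instance Definition _ N := isMeasure.Build _ _ _ (tuple_measure (N := N))
  (tuple_measure0 N) (@tuple_measure_ge0 N)
  (@tuple_measure_sigma_additive N).

Let tuple_measure_sigma_finiteT N :
  sigma_finite setT (tuple_measure (N := N)).
Proof.
by have [m ->] := tuple_measure_sigma_finite N; exact: sigma_finiteT.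
Qed.

HB.instance Definition _ N := Measure_isSigmaFinite.Build _ _ _
  (tuple_measure (N := N)) (tuple_measure_sigma_finiteT N).

End tuple_measure.

Arguments tuple_measure {d T R} mu N.

Section complex_space.
Context (R : realType).

Definition enorm (N : nat) (x : Cspace R N) : R :=
  Num.sqrt (\sum_(i < N) Normc.normc (x 0 i) ^+ 2).

Definition plane := (measurableTypeR R * measurableTypeR R)%type.

HB.instance Definition _ := Measurable.on plane.

Definition plane_lebesgue : set plane -> \bar R :=
  (@lebesgue_measure R \x @lebesgue_measure R)%E.

HB.instance Definition _ := Measure.on plane_lebesgue.

HB.instance Definition _ := Measure_isSigmaFinite.Build _ _ _ plane_lebesgue
  (product_sigma_finite (@lebesgue_measure R) (@lebesgue_measure R)).

(* Lebesgue measure on C^N, carried by the N-tuples of points (a_i, b_i) of the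
   plane; [Cvec] sends such a tuple to the vector (a_i + i b_i)_i. *)
Definition Clebesgue (N : nat) := tuple_measure plane_lebesgue N.

Definition Cvec (N : nat) (t : N.-tuple plane) : Cspace R N :=
  \row_i ((tnth t i).1 +i* (tnth t i).2).

Definition cis (t : R) : R[i] := cos t +i* sin t.

(* Functions with values in [-oo, +oo) on U are total functions to [\bar R]
   whose values outside U are never used.  The third condition is the
   sub-mean value inequality on every closed complex disc contained in U. *)
Definition psh (N : nat) (U : set (Cspace R N)) (u : Cspace R N -> \bar R) :=
  [/\ forall x, U x -> (u x < +oo)%E,
      forall x, U x -> forall a : R, (u x < a%:E)%E ->
        \forall y \near x, (u y < a%:E)%E,
      forall x b : Cspace R N,
        (forall zeta : R[i], `|zeta| <= 1 -> U (x + zeta *: b)) ->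
        (u x <= ((2 * pi)^-1)%:E *
          \int[@lebesgue_measure R]_(t in `[0%R, (2 * pi)%R])
            u (x + cis t *: b)%R)%E &
      forall x, U x -> exists2 y, connected_component U x y & u y != -oo%E].

(* The neighborhoods are punctured because MathComp-Analysis sets [ln 0 = 0].
   In [\bar R], [0^-1 = +oo], so a positive number divided by a Lelong number
   equal to 0 is [+oo]. *)
Definition lelong (N : nat) (psi : Cspace R N -> \bar R) (x : Cspace R N) :
    \bar R :=
  ereal_sup [set c%:E | c in [set c : R | 0 <= c /\
    exists M : R, \forall y \near x^',
      (psi y <= (c * ln (enorm (y - x)) + M)%:E)%E]].

(* A germ at x is represented by the functions having this germ, so the ideals
   of germs below are sets of functions stable under equality near x. *)
Definition holo_germ (N : nat) (x : Cspace R N) :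
    set (Cspace R N -> (R[i])^o) :=
  [set f | \forall y \near x, differentiable f y].

(* The stalk at x of the multiplier ideal sheaf. *)
Definition multiplier_ideal (N : nat) (psi : Cspace R N -> \bar R)
    (x : Cspace R N) : set (Cspace R N -> (R[i])^o) :=
  [set f | holo_germ x f /\
    exists V : set (Cspace R N), [/\ open V, V x &
      (Clebesgue (N := N)).-integrable (@Cvec N @^-1` V)
        (fun t => (Normc.normc (f (Cvec t)) ^+ 2)%:E *
                  expeR (- (2%:E * psi (Cvec t))))%E]].

Definition sing_exponent (N : nat) (psi : Cspace R N -> \bar R)
    (x : Cspace R N) : \bar R :=
  ereal_sup [set c%:E | c in [set c : R | 0 <= c /\
    multiplier_ideal (fun y => c%:E * psi y)%E x = holo_germ x]].

End complex_space.

(* Main.v *)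
Require Import Defs.
From mathcomp Require Import all_boot all_order all_algebra complex.
From mathcomp Require Import all_classical all_reals all_analysis.
From mathcomp Require Import measurable_realfun ring lra.
Import Order.TTheory GRing.Theory Num.Theory numFieldNormedType.Exports.

(** The extension is a supremum over polydiscs.  Let |w| be the maximum norm of
    w in C^m, where m = (2^k - 1) n, and let Phi(z, w) be the supremum of phi on
    the closed polydisc of centre z and radius |w|, defined where this polydisc
    lies in D.  One formula serves for every k.

    Phi is plurisubharmonic: upper semicontinuity comes from the compactness of
    polydiscs, and for the mean value inequality every point of the polydisc has
    the form z + G w with G linear and of norm at most 1, so that Phi is
    the supremum over such G of the functions (z, w) |-> phi (z + G w)
    ([polydisc_sup_submean]).  It restricts to phi on w = 0 and has the same
    Lelong number at (z, 0), since a bound phi <= c log |. - z| + O(1) on the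
    polydisc of radius rho about z passes to Phi at distance rho from (z, 0)
    ([log_bounded_polydisc_sup]).

    The upper bound for the singularity exponent holds for any psi in dimension
    N = n + m = 2^k n: if psi <= c log |. - x| + O(1), then e^(-2 s psi) is at
    least of order h^(-2 s c) on a box of side h near x, whose volume is
    h^(2 N), so that integrability forces s c <= N ([log_bounded_exponent]).

    The lower bound rests on the fact that if c exceeds the Lelong number of phi
    at z, then sup phi >= c log r + C on the polydisc of radius r about y, with
    constants that are uniform for y close to z ([polydisc_lower_bound]).  It
    follows from the three circles inequality ([three_circles]), that is, the
    convexity of this supremum in log r.  Hence Phi >= c log |w| + C near (z, 0),
    and e^(-2 s Phi) is locally integrable as soon as s c < m, which is seen by
    summing over the shells of |w| ([multiplier_ideal_log_pole]).

    The three circles inequality is a maximum principle against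
    a log |zeta| + const.  Subtracting eps |zeta|^2 makes this comparison function
    strictly superharmonic, and the mean of log over a circle about x is
    controlled without integrating it, from the pointwise identity
    (x + b) (x - b) (x + ib) (x - ib) = x^4 - b^4. *)

Set Implicit Arguments.
Unset Strict Implicit.
Unset Printing Implicit Defensive.

Import Normc.
Local Open Scope classical_set_scope.
Local Open Scope ring_scope.
Local Open Scope complex_scope.

(** * The polydisc norm and the topology of complex space *)

Section complex_plane.
Context {R : realType}.
Implicit Types (x y : R[i]).

Lemma normr_normc x : `|x| = (normc x)%:C.
Proof. by []. Qed.

Lemma normc_ge0 x : 0 <= normc x.
Proof. by have := normr_ge0 x; rewrite normr_normc lecR. Qed.

Lemma normc_gt0 x : (0 < normc x) = (x != 0).
Proof. by rewrite -normr_gt0 normr_normc ltcR. Qed.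

Lemma normcD x y : normc (x + y) <= normc x + normc y.
Proof. by have := ler_normD x y; rewrite !normr_normc -rmorphD lecR. Qed.

Lemma normc_opp x : normc (- x) = normc x.
Proof. by have := normrN x; rewrite !normr_normc => -[]. Qed.

Lemma normc_sub x y : normc (x - y) = normc (y - x).
Proof. by rewrite -normc_opp opprB. Qed.

Lemma normc_real (a : R) : normc a%:C = `|a|.
Proof. by rewrite /normc /= expr0n addr0 sqrtr_sqr. Qed.

Lemma normcX x n : normc (x ^+ n) = normc x ^+ n.
Proof.
by elim: n => [|n IH]; rewrite ?expr0 ?normc1 // !exprS normcM IH.
Qed.

Lemma normc_sqr x : normc x ^+ 2 = complex.Re x ^+ 2 + complex.Im x ^+ 2.
Proof. by case: x => a b; rewrite sqr_sqrtr // addr_ge0 ?sqr_ge0. Qed.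

Lemma Re_le_normc x : `|complex.Re x| <= normc x.
Proof. by have := normc_ge_Re x; rewrite normr_normc lecR. Qed.

Lemma Im_le_normc x : `|complex.Im x| <= normc x.
Proof.
rewrite -(@ler_pXn2r _ 2) ?nnegrE ?normc_ge0 // normc_sqr real_normK ?num_real //.
by rewrite lerDr sqr_ge0.
Qed.

Lemma normc_le_Re_Im x : normc x <= `|complex.Re x| + `|complex.Im x|.
Proof.
rewrite -(@ler_pXn2r _ 2) ?nnegrE ?normc_ge0 ?addr_ge0 // normc_sqr sqrrD.
rewrite !real_normK ?num_real // [leRHS]addrAC lerDl.
by rewrite mulrn_wge0 // mulr_ge0.
Qed.

Lemma normc_cis (t : R) : normc (cis t) = 1.
Proof.
by apply/eqP; rewrite -(@eqrXn2 _ 2) ?normc_ge0 // normc_sqr /= cos2Dsin2 expr1n.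
Qed.

Lemma near_planeP (x : (R[i])^o) (P : (R[i])^o -> Prop) :
  (\forall y \near x, P y) <->
  exists2 d : R, 0 < d & forall y, normc (y - x) < d -> P y.
Proof.
split.
  move=> /nbhs_ballP [e e0 be]; have : 0 < e by exact: e0.
  rewrite ltcE /= => /andP[/eqP eI eR]; exists (complex.Re e) => // y yx.
  apply: be; rewrite /ball /= distrC normr_normc.
  by case: e eI eR yx {e0} => a b /= -> _; rewrite ltcR.
move=> [d d0 dP]; apply/nbhs_ballP; exists d%:C; first by rewrite /= ltcR.
by move=> y; rewrite /ball /= normr_normc ltcR normc_sub => /dP.
Qed.

Lemma continuous_normc : continuous (fun x : (R[i])^o => normc x).
Proof.
move=> x; apply/(@cvgrPdist_lt _ _ _ (nbhs x) (nbhs_filter x)) => e e0.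
apply/near_planeP; exists e => // y.
apply: le_lt_trans; rewrite ler_norml.
have := normcD y (x - y); have := normcD x (y - x).
rewrite ![_ + (_ - _)]addrC !subrK (normc_sub x y) => h1 h2.
by apply/andP; split; lra.
Qed.

Lemma compact_square (r : R) :
  compact [set x : (R[i])^o | `|complex.Re x| <= r /\ `|complex.Im x| <= r].
Proof.
have cI := @segment_compact R (- r) r.
pose f (p : R * R) : (R[i])^o := p.1 +i* p.2.
rewrite (_ : mkset _ = f @` (`[- r, r] `*` `[- r, r])); last first.
  apply/seteqP; split => [x /= [h1 h2]|x [[a b] /= [h1 h2]] <-].
    exists (complex.Re x, complex.Im x); last by case: x {h1 h2}.
    by split; rewrite /= in_itv /= -ler_norml.
  by rewrite /f /= !ler_norml; move: h1 h2; rewrite !in_itv.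
apply: continuous_compact; last exact: compact_setX.
apply: continuous_subspaceT => -[a b]; apply/cvgrPdist_lt => e.
rewrite ltcE => /andP[/eqP eI eR].
have e2 : 0 < complex.Re e / 2 by rewrite divr_gt0.
near=> p.
have : `|complex.Re ((a +i* b) - f p)| < complex.Re e / 2.
  rewrite /=; near: p; apply: (@cvgr_dist_lt _ _ _ (nbhs (a, b)) _ fst a) => //.
  exact: cvg_fst.
have : `|complex.Im ((a +i* b) - f p)| < complex.Re e / 2.
  rewrite /=; near: p; apply: (@cvgr_dist_lt _ _ _ (nbhs (a, b)) _ snd b) => //.
  exact: cvg_snd.
move=> h1 h2; rewrite normr_normc ltcE; apply/andP; split; first by rewrite eI.
apply: le_lt_trans (normc_le_Re_Im _) _.
by rewrite [ltRHS]splitr ltrD.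
Unshelve. all: by end_near.
Qed.

Lemma closed_annulus (r s : R) :
  closed [set x : (R[i])^o | r <= normc x <= s].
Proof.
rewrite -[X in closed X]setCK; apply: open_closedC.
rewrite openE => x /= /negP; rewrite negb_and -!ltNge => /orP[h|h];
  apply/near_planeP; [exists (r - normc x)|exists (normc x - s)]; rewrite ?subr_gt0 //;
  move=> y hy /=; apply/negP; rewrite negb_and -!ltNge.
- apply/orP; left; have := normcD x (y - x); rewrite [x + _]addrC subrK; lra.
- apply/orP; right; have := normcD y (x - y).
  by rewrite [y + _]addrC subrK (normc_sub x y); lra.
Qed.

Lemma compact_annulus (r s : R) :
  compact [set x : (R[i])^o | r <= normc x <= s].
Proof.
apply: (subclosed_compact (closed_annulus (r := r) (s := s)) (compact_square (r := s))).
move=> x /= /andP[_ h]; split; apply: le_trans h.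
  exact: Re_le_normc.
exact: Im_le_normc.
Qed.

End complex_plane.

Section polydisc_norm.
Context {R : realType}.

Definition nrm (N : nat) (x : Cspace R N) : R :=
  \big[Num.max/0]_(i < N) normc (x 0 i).

Lemma nrm_leP N (x : Cspace R N) r :
  reflect (0 <= r /\ forall i, normc (x 0 i) <= r) (nrm x <= r).
Proof.
by rewrite /nrm; apply: (iffP (bigmax_leP _ _ _ _)) => -[r0 h]; split=> // i *; exact: h.
Qed.

Lemma nrm_ge0 N (x : Cspace R N) : 0 <= nrm x.
Proof. by have /nrm_leP[] := lexx (nrm x). Qed.
Hint Resolve nrm_ge0 : core.

Lemma nrm_coord N (x : Cspace R N) i : normc (x 0 i) <= nrm x.
Proof. by have /nrm_leP[_] := lexx (nrm x). Qed.

Lemma nrm_attained N (x : Cspace R N) : (0 < N)%N ->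
  exists j, nrm x = normc (x 0 j).
Proof.
case: N x => // N x _.
have [|j _ hj] := @eq_bigmax _ _ _ (0 : R) (ord0 : 'I_N.+1) predT
  (fun i => normc (x 0 i)) isT.
  by move=> i _; exact: normc_ge0.
by exists j.
Qed.

Lemma nrm0 N : nrm (0 : Cspace R N) = 0.
Proof.
apply/eqP; rewrite eq_le nrm_ge0 andbT; apply/nrm_leP; split=> // i.
by rewrite mxE normc0.
Qed.

Lemma nrm_gt0 N (x : Cspace R N) : (0 < nrm x) = (x != 0).
Proof.
apply/idP/idP => [|x0]; first by apply: contraTneq => ->; rewrite nrm0 ltxx.
rewrite lt_neqAle nrm_ge0 andbT; apply: contra_neq x0 => n0.
apply/rowP => i; rewrite mxE; apply: (@eq0_normc R); apply/eqP.
by rewrite eq_le normc_ge0 andbT [leRHS]n0 nrm_coord.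
Qed.

Lemma nrmD N (x y : Cspace R N) : nrm (x + y) <= nrm x + nrm y.
Proof.
apply/nrm_leP; split=> [|i]; first by rewrite addr_ge0.
by rewrite mxE (le_trans (normcD _ _)) // lerD // nrm_coord.
Qed.

Lemma nrmZ N (a : R[i]) (x : Cspace R N) : nrm (a *: x) = normc a * nrm x :> R.
Proof.
apply/eqP; rewrite eq_le; apply/andP; split.
  apply/nrm_leP; split=> [|i]; first by rewrite mulr_ge0 ?normc_ge0.
  by rewrite mxE normcM ler_wpM2l ?normc_ge0 // nrm_coord.
have [->|a0] := eqVneq a 0; first by rewrite normc0 mul0r.
rewrite -ler_pdivlMl ?normc_gt0 //; apply/nrm_leP; split=> [|i].
  by rewrite mulr_ge0 // invr_ge0 normc_ge0.
rewrite ler_pdivlMl ?normc_gt0 // -normcM.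
by have := nrm_coord (a *: x) i; rewrite mxE.
Qed.

Lemma nrmZr N (a : R) (x : Cspace R N) : 0 <= a -> nrm (a%:C *: x) = a * nrm x.
Proof. by move=> a0; rewrite nrmZ normc_real ger0_norm. Qed.

Lemma nrmN N (x : Cspace R N) : nrm (- x) = nrm x.
Proof. by rewrite -scaleN1r nrmZ normc_opp normc1 mul1r. Qed.

Lemma nrm_sub N (x y : Cspace R N) : nrm (x - y) = nrm (y - x).
Proof. by rewrite -nrmN opprB. Qed.

Lemma nrm_row_mx N1 N2 (x : Cspace R N1) (y : Cspace R N2) :
  nrm (row_mx x y) = Num.max (nrm x) (nrm y).
Proof.
apply/eqP; rewrite eq_le; apply/andP; split.
  apply/nrm_leP; split=> [|i]; first by rewrite le_max nrm_ge0.
  rewrite le_max; case: (split_ordP i) => j ->.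
    by rewrite row_mxEl nrm_coord.
  by rewrite row_mxEr nrm_coord orbT.
rewrite ge_max; apply/andP; split; apply/nrm_leP; split=> // i.
  by have := nrm_coord (row_mx x y) (lshift N2 i); rewrite row_mxEl.
by have := nrm_coord (row_mx x y) (rshift N1 i); rewrite row_mxEr.
Qed.

(** Neighbourhoods are balls for a complex-valued radius; this is the same
    statement with the real-valued norm. *)
Lemma nearP N (x : Cspace R N) (P : Cspace R N -> Prop) :
  (\forall y \near x, P y) <->
  exists2 d : R, 0 < d & forall y, nrm (y - x) < d -> P y.
Proof.
split.
  move=> /nbhs_ballP [e e0 be]; have : 0 < e by exact: e0.
  rewrite ltcE /= => /andP[/eqP eI eR]; exists (complex.Re e) => // y yx.
  apply: be; split=> // i j; rewrite /ball /= distrC normr_normc.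
  rewrite (ord1 i).
  have : normc (y 0 j - x 0 j) < complex.Re e.
    by apply: le_lt_trans yx; have := nrm_coord (y - x) j; rewrite !mxE.
  by case: e eI eR yx {e0} => a b /= -> _ _; rewrite ltcR.
move=> [d d0 dP]; apply/nbhs_ballP; exists d%:C; first by rewrite /= ltcR.
move=> y [_ hy]; apply: dP.
have -> : (nrm (y - x) < d) = ~~ (d <= nrm (y - x)) by rewrite -ltNge.
apply/negP => dn.
have N0 : (0 < N)%N.
  rewrite lt0n; apply: contraTneq dn => N0; rewrite -ltNge.
  apply: le_lt_trans d0; apply/nrm_leP; split=> // i.
  by have := ltn_ord i; rewrite [X in (_ < X)%N]N0.
have [j hj] := nrm_attained (y - x) N0.
move: dn; rewrite hj leNgt; have := hy 0 j; rewrite /ball /= normr_normc ltcR.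
by rewrite normc_sub !mxE => ->.
Qed.

(** The two norms are equivalent: only the additive constant in the definition
    of the Lelong number depends on the choice. *)
Lemma enorm_ge_nrm N (x : Cspace R N) : nrm x <= enorm x.
Proof.
apply/nrm_leP; split=> [|i]; first exact: sqrtr_ge0.
rewrite -(@ler_pXn2r _ 2) ?nnegrE ?normc_ge0 ?sqrtr_ge0 // sqr_sqrtr; last first.
  by rewrite sumr_ge0 // => j _; rewrite sqr_ge0.
by rewrite (bigD1 i) //= lerDl sumr_ge0 // => j _; rewrite sqr_ge0.
Qed.

Lemma enorm_le_nrm N (x : Cspace R N) : enorm x <= N%:R * nrm x.
Proof.
rewrite -(@ler_pXn2r _ 2) ?nnegrE ?mulr_ge0 ?sqrtr_ge0 // sqr_sqrtr; last first.
  by rewrite sumr_ge0 // => j _; rewrite sqr_ge0.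
apply: (@le_trans _ _ (\sum_(i < N) nrm x ^+ 2)).
  apply: ler_sum => i _; rewrite ler_pXn2r ?nnegrE ?normc_ge0 //.
  exact: nrm_coord.
rewrite sumr_const card_ord exprMn -[leLHS]mulr_natl ler_wpM2r ?sqr_ge0 //.
by rewrite -natrX ler_nat; case: N {x} => // N; rewrite expnS expn1 leq_pmulr.
Qed.

Lemma compact_polydisc N (r : R) : compact [set x : Cspace R N | nrm x <= r].
Proof.
have [r0|r0] := leP 0 r; last first.
  rewrite (_ : mkset _ = set0); first exact: compact0.
  by rewrite -subset0 => x /= h; have := le_lt_trans h r0; rewrite ltNge nrm_ge0.
suff -> : [set x : Cspace R N | nrm x <= r] =
    [set x : Cspace R N | forall i, [set y : (R[i])^o | 0 <= normc y <= r] (x ord0 i)].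
  exact: (@rV_compact (R[i])^o N _ (fun=> @compact_annulus R 0 r)).
apply/seteqP; split=> x /= => [/nrm_leP[_ h] i|h].
  by rewrite normc_ge0 h.
by apply/nrm_leP; split=> // i; have /andP[] := h i.
Qed.

Lemma compact_polydisc_at N (z : Cspace R N) (r : R) :
  compact [set x : Cspace R N | nrm (x - z) <= r].
Proof.
suff -> : [set x : Cspace R N | nrm (x - z) <= r] =
    (fun x => x + z) @` [set x : Cspace R N | nrm x <= r].
  apply: (continuous_compact _ (@compact_polydisc N r)).
  apply: continuous_subspaceT => x.
  apply: (@cvgD _ _ _ (nbhs x) (nbhs_filter x) id (cst z) x z) => //.
  exact: cvg_cst.
apply/seteqP; split=> [x /= h|_ [x /= h <-]]; last by rewrite /= addrK.
by exists (x - z) => //; rewrite subrK.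
Qed.

Lemma nrm_dist_triangle N (x y z : Cspace R N) :
  nrm (x - z) <= nrm (x - y) + nrm (y - z).
Proof. by have := nrmD (x - y) (y - z); rewrite addrA subrK. Qed.

(** Along a ray from the centre a point moves from the polydisc of radius r + d
    into the polydisc of radius r by less than d, so that it is enough to find a
    common radius d for the points of the closed polydisc. *)
Lemma polydisc_thicken N (U : set (Cspace R N)) (z : Cspace R N) (r : R) :
  open U -> 0 <= r -> (forall xi, nrm (xi - z) <= r -> U xi) ->
  exists2 d, 0 < d & forall xi, nrm (xi - z) < r + d -> U xi.
Proof.
move=> oU r0 zrU.
have /compact_near_coveringP cK := @compact_polydisc_at N z r.
have FF : ProperFilter (0 : R)^'+ by exact: at_right_proper_filter.
have := cK R (0 : R)^'+ (fun d x => forall y, nrm (y - x) < d -> U y) _.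
case=> [x xr|d /= d0 dP].
  have /nearP [e e0 eP] : nbhs x U by exact: oU (zrU _ xr).
  exists ([set x' : Cspace R N | nrm (x' - x) < e / 2], [set d | d < e / 2]).
    split => /=; last by apply: nbhs_right_lt; rewrite divr_gt0.
    by apply/nearP; exists (e / 2); rewrite ?divr_gt0.
  move=> [x' d] /= [h1 h2] y h3; apply: eP.
  apply: le_lt_trans (nrm_dist_triangle y x' x) _; rewrite (splitr e).
  by rewrite ltrD // (lt_trans h3).
have {}dP : forall e, 0 < e -> e < d -> forall x, nrm (x - z) <= r ->
    forall y, nrm (y - x) < e -> U y.
  move=> e e0 ed x xr; apply: dP => //=.
  by rewrite sub0r normrN gtr0_norm.
have d2 : 0 < d / 2 by rewrite divr_gt0.
exists (d / 2) => // xi h; have [xir|rxi] := leP (nrm (xi - z)) r; first exact: zrU.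
have rho0 : 0 < nrm (xi - z) by exact: le_lt_trans r0 rxi.
have r1 : r / nrm (xi - z) <= 1 by rewrite ler_pdivrMr // mul1r ltW.
apply: (dP (d / 2) _ _ (z + (r / nrm (xi - z))%:C *: (xi - z))) => //.
- by rewrite ltr_pdivrMr // ltr_pMr // ltr1n.
- by rewrite addrAC subrr add0r nrmZ normc_real ger0_norm ?divr_ge0 // divfK // gt_eqF.
rewrite opprD addrA -{1}(scale1r (xi - z)) -scalerBl nrmZ.
rewrite (_ : 1 - _ = (1 - r / nrm (xi - z))%:C) ; last by rewrite rmorphB rmorph1.
by rewrite normc_real ger0_norm ?subr_ge0 // mulrBl mul1r divfK ?gt_eqF // ltrBlDl.
Qed.

End polydisc_norm.
#[local] Hint Resolve nrm_ge0 : core.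

(** * The three circles inequality in one complex variable *)

Section circle_means.
Context {R : realType}.
Local Open Scope ereal_scope.

Import HBNNSimple.

(** The positive and negative parts of an integral are suprema over the simple
    functions below the integrand, and these suprema compare directly. *)
Lemma integral_mono d (T : measurableType d) (mu : {measure set T -> \bar R})
    (D : set T) (f g : T -> \bar R) :
  (forall x, D x -> f x <= g x) ->
  \int[mu]_(x in D) f x <= \int[mu]_(x in D) g x.
Proof.
move=> fg; have fgD x : (f \_ D) x <= (g \_ D) x.
  by rewrite /patch; case: ifPn => // /set_mem /fg.
rewrite /integral; apply: leeB; apply: ereal_sup_le => _ [h hle <-];
  exists h => // x; apply: le_trans (hle x) _.
- by apply: (@funepos_le _ _ setT) => [y _|]; rewrite ?inE.
- by apply: (@funeneg_le _ _ setT) => [y _|]; rewrite ?inE.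
Qed.

Definition circle_mean (f : R -> \bar R) : \bar R :=
  ((2 * pi)^-1)%:E * \int[@lebesgue_measure R]_(t in `[0%R, (2 * pi)%R]) f t.

Lemma circle_mean_mono (f g : R -> \bar R) :
  (forall t, f t <= g t) -> circle_mean f <= circle_mean g.
Proof.
move=> fg; rewrite /circle_mean lee_pmul2l //; first exact: integral_mono.
by rewrite lte_fin invr_gt0 mulr_gt0 // pi_gt0.
Qed.

Lemma circle_mean_cst (c : R) : circle_mean (fun=> c%:E) = c%:E.
Proof.
rewrite /circle_mean integral_cst //= lebesgue_measure_itv /= lte_fin.
have p0 : (0 < 2 * pi :> R)%R by rewrite mulr_gt0 // pi_gt0.
by rewrite p0 sube0 -!EFinM mulrCA mulVf ?mulr1 ?gt_eqF.
Qed.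

Lemma circle_meanD (f g : R -> R) : continuous f -> continuous g ->
  circle_mean (fun t => (f t + g t)%:E) =
  circle_mean (fun t => (f t)%:E) + circle_mean (fun t => (g t)%:E).
Proof.
move=> cf cg.
have ci (h : R -> R) : continuous h -> lebesgue_measure.-integrable
    (`[0%R, (2 * pi)%R] : set (measurableTypeR R)) (EFin \o h).
  move=> ch; apply: continuous_compact_integrable; first exact: segment_compact.
  exact: continuous_subspaceT.
have mD : measurable (`[0%R, (2 * pi)%R] : set (measurableTypeR R)) by [].
rewrite /circle_mean; under eq_integral do rewrite EFinD.
rewrite (integralD mD (ci f cf) (ci g cg)) muleDr // fin_num_adde_defr //.
exact: (integrable_fin_num mD (ci f cf)).
Qed.

End circle_means.

Section upper_semicontinuity.
Context {R : realType}.
Local Open Scope ereal_scope.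

(** A function without maximum would give every point of the compact set a
    point of larger value; the tails of K for the order of the values of u form
    a filter along which compactness makes this choice uniform. *)
Lemma usc_attains_max (T : topologicalType) (K : set T) (u : T -> \bar R) :
  compact K -> K !=set0 ->
  (forall x, K x -> forall a : R, u x < a%:E -> \forall y \near x, u y < a%:E) ->
  exists2 x, K x & forall y, K y -> u y <= u x.
Proof.
move=> /compact_near_coveringP cK [x0 Kx0] uscu; apply: contrapT => nomax.
have larger x : K x -> exists2 y, K y & u x < u y.
  move=> Kx; apply: contrapT => nox; apply: nomax; exists x => // y Ky.
  by rewrite leNgt; apply/negP => uxy; apply: nox; exists y.
pose F := filter_from K (fun y0 => [set y | K y /\ u y0 <= u y]).
have FF : Filter F.
  apply: filter_from_filter; first by exists x0.
  move=> i j Ki Kj; have [ij|/ltW ji] := leP (u i) (u j).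
    by exists j => // y [Ky jy]; split; split=> //; exact: le_trans ij jy.
  by exists i => // y [Ky iy]; split; split=> //; exact: le_trans ji iy.
have := cK T F (fun y x => u x < u y) FF.
case=> [x Kx|y0 Ky0 /= /(_ y0)].
  have [y Ky uxy] := larger x Kx.
  have [a /andP[uxa auy]] : exists a : R, u x < a%:E <= u y.
    case: (u x) (u y) uxy => [p||] [q||] //= h.
    - by exists q; rewrite h lexx.
    - by exists (p + 1)%R; rewrite lte_fin ltrDl ltr01 leey.
    - by exists q; rewrite ltNyr lexx.
    - by exists 0%R; rewrite ltNyr leey.
  exists ([set x' | u x' < a%:E], [set y' | K y' /\ u y <= u y']) => /=.
    by split; [exact: uscu|exists y].
  by move=> [x' y'] /= [h1 [_ h2]]; apply: lt_le_trans h1 (le_trans auy h2).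
by move=> /(_ (conj Ky0 (lexx _))) /(_ _ Ky0); rewrite ltxx.
Qed.

End upper_semicontinuity.

Section three_circles.
Context {R : realType}.

Lemma continuous_normc_circle (x b : R[i]) :
  continuous (fun t : R => normc (x + cis t * b)).
Proof.
case: x b => p q [c d] t; rewrite /normc /=.
apply: continuous_comp; last exact: sqrt_continuous.
have cC : {for t, continuous (@cos R)} by exact: continuous_cos.
have cS : {for t, continuous (@sin R)} by exact: continuous_sin.
apply: continuousD; apply: (@continuous_comp _ _ _ _ (fun y : R => y ^+ 2)).
- apply: continuousD; first exact: cvg_cst.
  by apply: continuousB; apply: continuousM => //; exact: cvg_cst.
- exact: exprn_continuous.
- apply: continuousD; first exact: cvg_cst.
  by apply: continuousD; apply: continuousM => //; exact: cvg_cst.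
- exact: exprn_continuous.
Qed.

(** The four factors multiply to x^4 - y^4, so that the first-, second- and
    third-order terms in y cancel. *)
Lemma lnD4_normc (x y : R[i]) : normc y < normc x ->
  ln (normc (x + y)) + ln (normc (x - y)) +
  (ln (normc (x + 'i * y)) + ln (normc (x - 'i * y)))
  <= ln (normc x) *+ 4 + (normc y / normc x) ^+ 4.
Proof.
move=> yx; have x0 : 0 < normc x by apply: le_lt_trans yx; exact: normc_ge0.
have pos z : normc z = normc y -> 0 < normc (x + z).
  move=> zy; have := normcD (x + z) (- z); rewrite addrK normc_opp zy.
  by move=> h; rewrite -(ltrD2r (normc y)) add0r; exact: lt_le_trans yx h.
have i1 : normc ('i : R[i]) = 1 by rewrite /normc /= expr0n add0r expr1n sqrtr1.
have p1 := pos y erefl; have p2 := pos (- y) (normc_opp _).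
have p3 : 0 < normc (x + 'i * y) by apply: pos; rewrite normcM i1 mul1r.
have p4 : 0 < normc (x - 'i * y).
  by apply: pos; rewrite normc_opp normcM i1 mul1r.
rewrite -lnXn // -!lnM ?posrE ?mulr_gt0 // -!normcM.
have -> : (x + y) * (x - y) * ((x + 'i * y) * (x - 'i * y)) = x ^+ 4 - y ^+ 4.
  have ii : 'i * 'i = -1 :> R[i] by rewrite -expr2 sqr_i.
  transitivity ((x ^+ 2 - y ^+ 2) * (x ^+ 2 - ('i * 'i) * y ^+ 2)); first by ring.
  by rewrite ii; ring.
have n4 : 0 < normc (x ^+ 4 - y ^+ 4).
  have := normcD (x ^+ 4 - y ^+ 4) (y ^+ 4); rewrite subrK !normcX.
  have : normc y ^+ 4 < normc x ^+ 4.
    by rewrite ltr_pXn2r // nnegrE normc_ge0.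
  by move=> h1 h2; rewrite -(ltrD2r (normc y ^+ 4)) add0r; exact: lt_le_trans h1 h2.
have : normc (x ^+ 4 - y ^+ 4) <= normc x ^+ 4 * (1 + (normc y / normc x) ^+ 4).
  rewrite mulrDr mulr1 exprMn exprVn mulrCA mulfV ?mulr1; last first.
    by rewrite expf_neq0 // gt_eqF.
  by have := normcD (x ^+ 4) (- y ^+ 4); rewrite normc_opp !normcX.
have r0 : 0 <= (normc y / normc x) ^+ 4.
  by rewrite exprn_ge0 // divr_ge0 ?normc_ge0.
rewrite -ler_ln ?posrE ?mulr_gt0 ?exprn_gt0 ?ltr_wpDr // => /le_trans; apply.
rewrite lnM ?posrE ?exprn_gt0 ?ltr_wpDr // lerD2l le_ln1Dx //.
by rewrite (lt_le_trans _ r0) // ltrN10.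
Qed.

Lemma parallelogram4 (x y : R[i]) :
  normc (x + y) ^+ 2 + normc (x - y) ^+ 2 +
  (normc (x + 'i * y) ^+ 2 + normc (x - 'i * y) ^+ 2)
  = (normc x ^+ 2 + normc y ^+ 2) *+ 4.
Proof. by rewrite !normc_sqr; case: x y => a b [c d] /=; ring. Qed.


(* Apart from an additive constant, the function to which a subharmonic function
   on an annulus is compared; a log |y| alone has equality in the mean value
   inequality, and the quadratic term makes the inequality strict. *)
Local Notation barrier a eps y := (a * ln (normc y) - eps * normc y ^+ 2).

Lemma barrier_circle_lt (a eps rho : R) (x b : R[i]) :
  0 < rho -> rho < 1 -> 0 <= a -> 0 < eps -> x != 0 ->
  normc b = rho * normc x -> a * rho < 4 * eps * normc x ^+ 2 ->
  barrier a eps (x + b) + barrier a eps (x - b) +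
  (barrier a eps (x + 'i * b) + barrier a eps (x - 'i * b))
  <= 4 * barrier a eps x - (4 * eps * normc x ^+ 2 - a * rho) * rho ^+ 2.
Proof.
move=> rho0 rho1 a0 eps0 x0 bE small; have nx0 : 0 < normc x by rewrite normc_gt0.
have bx : normc b < normc x by rewrite bE gtr_pMl.
have := ler_wpM2l a0 (lnD4_normc bx); have := parallelogram4 x b.
have -> : normc b / normc x = rho by rewrite bE mulfK // gt_eqF.
rewrite bE => h1 h2.
have h3 : a * rho ^+ 4 <= a * rho ^+ 3.
  by rewrite ler_wpM2l // exprS ger_pMl ?exprn_gt0 // ltW.
rewrite [leLHS](_ : _ = a * (ln (normc (x + b)) + ln (normc (x - b)) +
    (ln (normc (x + 'i * b)) + ln (normc (x - 'i * b)))) -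
  eps * (normc (x + b) ^+ 2 + normc (x - b) ^+ 2 +
    (normc (x + 'i * b) ^+ 2 + normc (x - 'i * b) ^+ 2))); last by ring.
rewrite h1; apply: le_trans (lerD h2 (lexx _)) _; rewrite -subr_ge0.
rewrite [leRHS](_ : _ = a * rho ^+ 3 - a * rho ^+ 4) ?subr_ge0 //.
by move: (ln (normc x)) (normc x) => l X; ring.
Qed.

(** Averaging over the four discs of radius vectors b, -b, ib, -ib makes the
    barrier strictly superharmonic at small scale, by an inequality between
    its values that holds pointwise on the circle. *)
Lemma barrier_not_submean (a eps m d : R) (x : R[i]) :
  0 <= a -> 0 < eps -> 0 < d -> x != 0 ->
  exists2 b, normc b <= d &
    ((m + barrier a eps x)%:E >
      circle_mean (fun t => (m + barrier a eps (x + cis t * b))%:E))%E.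
Proof.
move=> a0 eps0 d0 x0; have nx0 : 0 < normc x by rewrite normc_gt0.
pose rho := Num.min (Num.min (1 / 2) (d / normc x)) (eps * normc x ^+ 2 / (a + 1)).
have rho0 : 0 < rho.
  by rewrite /rho !lt_min !divr_gt0 ?mulr_gt0 ?exprn_gt0 // ltr_wpDl.
have rho1 : rho < 1.
  by apply: (@le_lt_trans _ _ (1 / 2)); [rewrite /rho !ge_min lexx|lra].
have rhod : rho * normc x <= d.
  by rewrite -ler_pdivlMr // /rho !ge_min lexx orbT.
have small : a * rho < 4 * eps * normc x ^+ 2.
  have e0 : 0 < eps * normc x ^+ 2 by rewrite mulr_gt0 ?exprn_gt0.
  have : (a + 1) * rho <= eps * normc x ^+ 2.
    by rewrite mulrC -ler_pdivlMr ?ltr_wpDl // /rho !ge_min lexx !orbT.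
  by move=> h; rewrite -mulrA; move: h e0; lra.
pose b := rho%:C * x.
have bE : normc b = rho * normc x by rewrite normcM normc_real gtr0_norm.
have i1 : normc ('i : R[i]) = 1 by rewrite /normc /= expr0n add0r expr1n sqrtr1.
pose k (v : R[i]) t := m + barrier a eps (x + cis t * v).
have ck v : normc v = rho * normc x -> continuous (k v).
  move=> vE t; apply: cvgD; first exact: cvg_cst.
  apply: cvgB; apply: cvgM; [exact: cvg_cst| |exact: cvg_cst|].
    apply: (@continuous_comp _ _ _ (fun t => normc (x + cis t * v)) (@ln R)).
      exact: continuous_normc_circle.
    apply: continuous_ln; have := normcD (x + cis t * v) (- (cis t * v)).
    rewrite addrK normc_opp normcM normc_cis mul1r vE => h.
    rewrite -(ltrD2r (rho * normc x)) add0r; apply: lt_le_trans h.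
    by rewrite gtr_pMl.
  apply: (@continuous_comp _ _ _ (fun t => normc (x + cis t * v)) (fun y : R => y ^+ 2)).
    exact: continuous_normc_circle.
  exact: exprn_continuous.
apply: contrapT => nob.
have ge v : normc v = rho * normc x ->
    ((m + barrier a eps x)%:E <= circle_mean (fun t => (k v t)%:E))%E.
  move=> vE; rewrite leNgt; apply/negP => lt; apply: nob; exists v => //.
  by rewrite vE.
have c1 := ck b bE; have g1 := ge b bE.
have E2 : normc (- b) = rho * normc x by rewrite normc_opp.
have E3 : normc ('i * b) = rho * normc x by rewrite normcM i1 mul1r.
have E4 : normc (- ('i * b)) = rho * normc x by rewrite normc_opp.
have c2 := ck _ E2; have g2 := ge _ E2; have c3 := ck _ E3; have g3 := ge _ E3.
have c4 := ck _ E4; have g4 := ge _ E4.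
have := leeD (leeD g1 g2) (leeD g3 g4).
rewrite -!circle_meanD //; last 2 first.
- by move=> t; apply: continuousD; [exact: c1|exact: c2].
- by move=> t; apply: continuousD; [exact: c3|exact: c4].
pose L := 4 * m + (4 * barrier a eps x - (4 * eps * normc x ^+ 2 - a * rho) * rho ^+ 2).
have : (circle_mean (fun t => (k b t + k (- b) t + (k ('i * b) t + k (- ('i * b)) t))%:E)
   <= L%:E)%E.
  rewrite -[leRHS]circle_mean_cst; apply: circle_mean_mono => t; rewrite lee_fin.
  have cbE : normc (cis t * b) = rho * normc x by rewrite normcM normc_cis mul1r.
  have := barrier_circle_lt rho0 rho1 a0 eps0 x0 cbE small.
  rewrite /k /L !mulrN !(mulrCA _ 'i); lra.
move=> h1 h2; have := le_trans h2 h1; rewrite -!EFinD lee_fin /L.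
have : 0 < (4 * eps * normc x ^+ 2 - a * rho) * rho ^+ 2.
  by rewrite mulr_gt0 ?exprn_gt0 // subr_gt0.
lra.
Qed.

Lemma three_circles (u : R[i] -> \bar R) (r s a C : R) : 0 < r -> 0 <= a ->
  (forall x, r <= normc x <= s -> (u x < +oo)%E) ->
  (forall x : (R[i])^o, r <= normc x <= s -> forall c : R, (u x < c%:E)%E ->
    \forall y \near x, (u y < c%:E)%E) ->
  (forall x b, (forall zeta, normc zeta <= 1 -> r <= normc (x + zeta * b) <= s) ->
    (u x <= circle_mean (fun t => u (x + cis t * b)%R))%E) ->
  (forall x, normc x = r \/ normc x = s -> (u x <= (a * ln (normc x) + C)%:E)%E) ->
  forall x, r <= normc x <= s -> (u x <= (a * ln (normc x) + C)%:E)%E.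
Proof.
move=> r0 a0 ufin usc submean bnd x0 Ax0; rewrite leNgt; apply/negP => gt0.
have s0 : 0 < s by case/andP: Ax0 => h1 h2; exact: lt_le_trans r0 (le_trans h1 h2).
have pos (x : R[i]) : r <= normc x <= s -> 0 < normc x.
  by case/andP=> h1 _; exact: lt_le_trans r0 h1.
(* The excess of u over the bound at x0 leaves room for a quadratic term. *)
have [eps eps0 epsP] : exists2 eps : R, 0 < eps &
    ((a * ln (normc x0) + C + eps * s ^+ 2)%:E < u x0)%E.
  have := ufin x0 Ax0; case: (u x0) gt0 => [q||] //; rewrite lte_fin => h _.
  exists ((q - (a * ln (normc x0) + C)) / 2 / s ^+ 2).
    by rewrite !divr_gt0 ?exprn_gt0 // subr_gt0.
  by rewrite lte_fin divfK ?expf_neq0 ?gt_eqF //; lra.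
pose h (y : R[i]) := barrier a eps y + (C + eps * s ^+ 2).
pose v (y : R[i]) := (u y - (h y)%:E)%E.
have hbnd (y : R[i]) : r <= normc y <= s -> a * ln (normc y) + C <= h y.
  case/andP=> h1 h2; rewrite /h.
  have : normc y ^+ 2 <= s ^+ 2 by rewrite ler_pXn2r // nnegrE ?normc_ge0 // ltW.
  by move=> /(ler_wpM2l (ltW eps0)); lra.
have v0 : (0 < v x0)%E.
  rewrite /v sube_gt0 //; apply: le_lt_trans epsP; rewrite lee_fin /h.
  have : 0 <= eps * normc x0 ^+ 2 by rewrite mulr_ge0 ?sqr_ge0 // ltW.
  lra.
have ch (x : (R[i])^o) : r <= normc x <= s -> {for x, continuous (h : (R[i])^o -> R)}.
  move=> /pos nx0.
  have cn := @continuous_normc R x.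
  apply: (@continuous_comp _ _ _ (fun y : (R[i])^o => normc y)
    (fun y => a * ln y - eps * y ^+ 2 + (C + eps * s ^+ 2)) x) => //.
  apply: cvgD; last exact: cvg_cst.
  apply: cvgB; apply: cvgM; [exact: cvg_cst| |exact: cvg_cst|].
    exact: continuous_ln.
  exact: exprn_continuous.
have vusc (x : (R[i])^o) : r <= normc x <= s -> forall c : R, (v x < c%:E)%E ->
    \forall y \near x, (v y < c%:E)%E.
  move=> Ax c vc.
  have [q [uq qc]] : exists q : R, (u x < q%:E)%E /\ q < c + h x.
    move: vc; rewrite /v; case: (u x) (ufin x Ax) => [p||] // _.
      rewrite -EFinB lte_fin => pc; exists ((p + (c + h x)) / 2).
      by rewrite lte_fin; split; lra.
    by move=> _; exists (c + h x - 1); rewrite ltNyr; split=> //; lra.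
  near=> y.
  have uy : (u y < q%:E)%E by near: y; exact: usc.
  have hy : `|h x - h y| < c + h x - q.
    near: y; apply: (@cvgr_dist_lt _ _ _ (nbhs x) (nbhs_filter x) h (h x) (ch x Ax)).
    by rewrite subr_gt0.
  rewrite /v; case: (u y) uy => [p||] //; rewrite ?ltNyr // -EFinB !lte_fin.
  move: hy; rewrite ltr_norml; lra.
have [x1 Ax1 max1] := usc_attains_max (compact_annulus (r := r) (s := s))
  (ex_intro _ x0 Ax0) vusc.
have v1 : (0 < v x1)%E by exact: lt_le_trans v0 (max1 _ Ax0).
have [m mE] : exists m : R, v x1 = m%:E.
  move: v1; rewrite /v; have := ufin x1 Ax1; case: (u x1) => [p||] // _.
  by rewrite -EFinB; eexists.
have uE : u x1 = (m + h x1)%:E.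
  move: mE; rewrite /v; case: (u x1) => [p||] // [<-]; by rewrite subrK.
move: v1; rewrite mE lte_fin => m0.
(* On the two circles h dominates the bound, hence u, so that the positive
   maximum of u - h is attained in the open annulus. *)
have inner : r < normc x1 < s.
  have nb : ~ (normc x1 = r \/ normc x1 = s).
    move=> /bnd; rewrite uE lee_fin; have := hbnd x1 Ax1; lra.
  case/andP: Ax1 => h1 h2; rewrite !lt_neqAle h1 h2 !andbT.
  by apply/andP; split; apply/eqP => E; apply: nb; [left|right].
have [b bd] := @barrier_not_submean a eps (m + (C + eps * s ^+ 2))
  (Num.min (normc x1 - r) (s - normc x1)) x1 a0 eps0 ltac:(by rewrite lt_min !subr_gt0)
  ltac:(by rewrite -normc_gt0; exact: pos).
(* Near x1 the function u lies below m + h, with equality at x1; hence m + h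
   would satisfy at x1 the mean value inequality that the barrier violates. *)
apply/negP; rewrite -leNgt.
have disc (zeta : R[i]) : normc zeta <= 1 -> r <= normc (x1 + zeta * b) <= s.
  move=> z1; move: bd; rewrite le_min => /andP[b1 b2].
  have zb : normc (zeta * b) <= normc b by rewrite normcM ler_piMl ?normc_ge0.
  have := normcD (x1 + zeta * b) (- (zeta * b)); have := normcD x1 (zeta * b).
  rewrite addrK normc_opp => h1 h2; apply/andP; split; lra.
have -> : (m + (C + eps * s ^+ 2) + barrier a eps x1)%:E = u x1.
  by rewrite uE /h; congr EFin; ring.
apply: le_trans (submean x1 b disc) _; apply: circle_mean_mono => t.
have := max1 (x1 + cis t * b) (disc _ _); rewrite normc_cis lexx mE => /(_ isT).
rewrite /v; case: (u _) => [p||] //=; rewrite ?leNye // -EFinB !lee_fin /h; lra.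
Unshelve. all: by end_near.
Qed.

End three_circles.

(** * Plurisubharmonic functions on polydiscs *)

Section psh_polydisc.
Context {R : realType}.

Lemma psh_usc N (U : set (Cspace R N)) u x (a : R) : psh U u -> U x ->
  (u x < a%:E)%E -> \forall y \near x, (u y < a%:E)%E.
Proof. by case=> _ h _ _ Ux; exact: h. Qed.

Lemma psh_lty N (U : set (Cspace R N)) u x : psh U u -> U x -> (u x < +oo)%E.
Proof. by case=> h _ _ _; exact: h. Qed.

Lemma psh_submean N (U : set (Cspace R N)) u x b : psh U u ->
  (forall zeta, normc zeta <= 1 -> U (x + zeta *: b)) ->
  (u x <= circle_mean (fun t => u (x + cis t *: b)%R))%E.
Proof.
by case=> _ _ h _ xb; apply: h => zeta; rewrite normr_normc lecR; exact: xb.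
Qed.

Lemma open_psh_sublevel N (U : set (Cspace R N)) u (a : R) : open U -> psh U u ->
  open [set x | U x /\ (u x < a%:E)%E].
Proof.
move=> oU pu; rewrite openE => x /= [Ux ux].
have h1 : \forall y \near x, U y by exact: oU.
have h2 := psh_usc pu Ux ux.
exact: (filterI h1 h2).
Qed.

Lemma psh_bounded_polydisc N (U : set (Cspace R N)) u z (r : R) : psh U u ->
  0 <= r -> (forall xi, nrm (xi - z) <= r -> U xi) ->
  exists B : R, forall xi, nrm (xi - z) <= r -> (u xi <= B%:E)%E.
Proof.
move=> pu r0 zrU.
have [|x xr a|x xr max] := @usc_attains_max R _ _ u (@compact_polydisc_at R N z r).
- by exists z; rewrite /= subrr nrm0.
- by apply: (psh_usc pu); exact: zrU.
have := psh_lty pu (zrU _ xr); case: (u x) max => [p||] // max _.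
  by exists p.
by exists 0 => xi h; apply: le_trans (max xi h) _; rewrite leNye.
Qed.

(** Every point of the shell lies on a complex line through the centre, on which
    the norm is the modulus of the parameter. *)
Lemma psh_three_circles N (U : set (Cspace R N)) u y (r s a C : R) :
  psh U u -> 0 < r -> 0 <= a ->
  (forall xi, nrm (xi - y) <= s -> U xi) ->
  (forall xi, nrm (xi - y) = r \/ nrm (xi - y) = s ->
     (u xi <= (a * ln (nrm (xi - y)) + C)%:E)%E) ->
  forall xi, r <= nrm (xi - y) <= s -> (u xi <= (a * ln (nrm (xi - y)) + C)%:E)%E.
Proof.
move=> pu r0 a0 ysU bnd xi rxs.
have rho0 : 0 < nrm (xi - y) by case/andP: rxs => h _; exact: lt_le_trans h.
pose e := (nrm (xi - y))^-1%:C *: (xi - y).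
have ne : nrm e = 1.
  by rewrite nrmZr ?invr_ge0 ?nrm_ge0 // mulVf // gt_eqF.
pose v (zeta : R[i]) := u (y + zeta *: e).
have nv zeta : nrm (y + zeta *: e - y) = normc zeta.
  by rewrite addrAC subrr add0r nrmZ ne mulr1.
have inU zeta : r <= normc zeta <= s -> U (y + zeta *: e).
  by case/andP=> _ h; apply: ysU; rewrite nv.
pose zeta0 : R[i] := (nrm (xi - y))%:C.
have n0 : normc zeta0 = nrm (xi - y) by rewrite normc_real ger0_norm ?nrm_ge0.
have v0 : v zeta0 = u xi.
  rewrite /v /e scalerA -rmorphM mulfV ?gt_eqF // rmorph1 scale1r.
  by rewrite addrC subrK.
rewrite -v0 -n0; apply: (@three_circles R v r s) => //; last by rewrite n0.
- by move=> x /inU; exact: psh_lty.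
- move=> x /inU Ux c /(psh_usc pu Ux) /nearP [d d0 dP].
  apply/near_planeP; exists d => // x' xx'; apply: dP.
  by rewrite opprD addrACA subrr add0r -scalerBl nrmZ ne mulr1.
- move=> x b xb.
  have E t : y + x *: e + t *: (b *: e) = y + (x + t * b) *: e.
    by rewrite scalerA scalerDl addrA.
  have -> : (fun t => v (x + cis t * b)) =
      (fun t => u (y + x *: e + cis t *: (b *: e))).
    by apply/funext => t; rewrite E.
  by apply: psh_submean pu _ => zeta /xb /inU; rewrite E.
- by move=> x rs; rewrite /v -nv; apply: bnd; rewrite nv.
Qed.

End psh_polydisc.

(** * Extension by suprema over polydiscs *)

Section extension.
Context {R : realType}.
Variables (n m : nat) (D : set (Cspace R n)) (phi : Cspace R n -> \bar R).

Definition polydisc_sup (x : Cspace R (n + m)) : \bar R :=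
  ereal_sup [set phi xi | xi in
    [set xi | nrm (xi - lsubmx x) <= nrm (rsubmx x)]].

Definition polydisc_domain : set (Cspace R (n + m)) :=
  [set x | forall xi, nrm (xi - lsubmx x) <= nrm (rsubmx x) -> D xi].

Lemma le_polydisc_sup x xi : nrm (xi - lsubmx x) <= nrm (rsubmx x) ->
  (phi xi <= polydisc_sup x)%E.
Proof. by move=> h; apply: ereal_sup_ubound; exists xi. Qed.

Lemma polydisc_sup_le x a :
  (forall xi, nrm (xi - lsubmx x) <= nrm (rsubmx x) -> (phi xi <= a)%E) ->
  (polydisc_sup x <= a)%E.
Proof. by move=> h; apply: ge_ereal_sup => _ [xi /= hxi <-]; exact: h. Qed.

Lemma nrm_sub0 N (x y : Cspace R N) : nrm (x - y) <= 0 -> x = y.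
Proof.
by move=> h; apply/eqP; rewrite -subr_eq0; apply: contraTT h; rewrite -nrm_gt0 -ltNge.
Qed.

Lemma polydisc_sup_restrict z : polydisc_sup (row_mx z 0) = phi z.
Proof.
apply/eqP; rewrite eq_le; apply/andP; split.
  by apply: polydisc_sup_le => xi; rewrite row_mxKl row_mxKr nrm0 => /nrm_sub0 ->.
by apply: le_polydisc_sup; rewrite row_mxKl row_mxKr nrm0 subrr nrm0.
Qed.

Lemma polydisc_domain_restrict z : D z -> polydisc_domain (row_mx z 0).
Proof. by move=> Dz xi; rewrite row_mxKl row_mxKr nrm0 => /nrm_sub0 ->. Qed.

Lemma nrm_lsub (x : Cspace R (n + m)) : nrm (lsubmx x) <= nrm x.
Proof. by rewrite -{2}(hsubmxK x) nrm_row_mx le_max lexx. Qed.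

Lemma nrm_rsub (x : Cspace R (n + m)) : nrm (rsubmx x) <= nrm x.
Proof. by rewrite -{2}(hsubmxK x) nrm_row_mx le_max lexx orbT. Qed.

Lemma near_polydisc (U : set (Cspace R n)) (x : Cspace R (n + m)) : open U ->
  (forall xi, nrm (xi - lsubmx x) <= nrm (rsubmx x) -> U xi) ->
  \forall y \near x, forall xi, nrm (xi - lsubmx y) <= nrm (rsubmx y) -> U xi.
Proof.
move=> oU xU; have [d d0 dP] := polydisc_thicken oU (nrm_ge0 _) xU.
apply/nearP; exists (d / 2); first by rewrite divr_gt0.
move=> y yx xi h; apply: dP; apply: le_lt_trans (nrm_dist_triangle _ (lsubmx y) _) _.
have h1 : nrm (lsubmx y - lsubmx x) < d / 2.
  by rewrite -raddfB; exact: le_lt_trans (nrm_lsub _) yx.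
have h2 : nrm (rsubmx y - rsubmx x) < d / 2.
  by rewrite -raddfB; exact: le_lt_trans (nrm_rsub _) yx.
have := nrmD (rsubmx y - rsubmx x) (rsubmx x); rewrite subrK; lra.
Qed.

Lemma open_polydisc_domain : open D -> open polydisc_domain.
Proof. by move=> oD; rewrite openE => x /near_polydisc; exact. Qed.

(** Let |w_j| be the norm of w and let eta be a point of the polydisc of that
    radius.  The linear map v |-> (v_j / w_j) eta sends w to eta and does not
    increase norms; hence (z, w) |-> phi (z + eta) extends to a function, the
    composite of phi with a linear map, that stays below the supremum. *)
Lemma polydisc_sup_submean (x b : Cspace R (n + m)) : (0 < m)%N -> psh D phi ->
  (forall zeta, normc zeta <= 1 -> polydisc_domain (x + zeta *: b)) ->
  (polydisc_sup x <= circle_mean (fun t => polydisc_sup (x + cis t *: b)%R))%E.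
Proof.
move=> m0 pphi xb; apply: polydisc_sup_le => xi hxi.
have [j jE] := nrm_attained (rsubmx x) m0.
pose eta := xi - lsubmx x; pose w := rsubmx x 0 j.
pose b' := lsubmx b + (rsubmx b 0 j / w) *: eta.
have inpoly (zeta : R[i]) : nrm (xi + zeta *: b' - lsubmx (x + zeta *: b))
    <= nrm (rsubmx (x + zeta *: b)).
  have -> : xi + zeta *: b' - lsubmx (x + zeta *: b) =
      (1 + zeta * (rsubmx b 0 j / w)) *: eta.
    have -> : lsubmx (x + zeta *: b) = lsubmx x + zeta *: lsubmx b.
      by rewrite linearD linearZ.
    rewrite /b' [zeta *: (_ + _)]scalerDr scalerA opprD addrACA.
    rewrite [RHS]scalerDl scale1r -/eta; congr (_ + _).
    by rewrite addrAC subrr add0r.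
  (* When w = 0 the polydisc is a point and eta = 0. *)
  rewrite nrmZ; have [w0|w0] := eqVneq w 0.
    suff -> : nrm eta = 0 by rewrite mulr0 nrm_ge0.
    by apply/eqP; rewrite eq_le nrm_ge0 andbT (le_trans hxi) // jE -/w w0 normc0.
  apply: (@le_trans _ _ (normc (1 + zeta * (rsubmx b 0 j / w)) * normc w)).
    by rewrite ler_wpM2l ?normc_ge0 // -jE.
  rewrite -normcM mulrDl mul1r -mulrA divfK //.
  by apply: le_trans (nrm_coord _ j); rewrite /w !mxE lexx.
have := @psh_submean R n D phi xi b' pphi.
move=> /(_ _) /le_trans; apply.
  by move=> zeta z1; apply: xb z1 _ _; exact: inpoly.
by apply: circle_mean_mono => t; exact: le_polydisc_sup.
Qed.

Lemma psh_polydisc_sup : (0 < m)%N -> open D -> psh D phi ->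
  psh polydisc_domain polydisc_sup.
Proof.
move=> m0 oD pphi; split.
- move=> x Dx; have [B hB] := psh_bounded_polydisc pphi (nrm_ge0 _) Dx.
  by apply: le_lt_trans (polydisc_sup_le hB) _; rewrite ltry.
- move=> x Dx a xa.
  have [q [xq qa]] : exists q : R, (polydisc_sup x < q%:E)%E /\ q < a.
    case: (polydisc_sup x) xa => [p||] // pa.
      by exists ((p + a) / 2); move: pa; rewrite !lte_fin; split; lra.
    by exists (a - 1); rewrite ltNyr; split=> //; lra.
  have hx xi : nrm (xi - lsubmx x) <= nrm (rsubmx x) -> D xi /\ (phi xi < q%:E)%E.
    by move=> h; split; [exact: Dx|exact: le_lt_trans (le_polydisc_sup h) xq].
  have := near_polydisc (open_psh_sublevel (a := q) oD pphi) hx.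
  apply: filterS => y yq; apply: (@le_lt_trans _ _ q%:E); last by rewrite lte_fin.
  by apply: polydisc_sup_le => xi /yq [_ /ltW].
- move=> x b xb; apply: polydisc_sup_submean => // zeta z1; apply: xb.
  by rewrite normr_normc lecR.
move=> x Dx; pose z := lsubmx x; pose w := rsubmx x.
have Dz : D z by apply: Dx; rewrite subrr nrm0 nrm_ge0.
have [_ _ _ /(_ z Dz) [y [C [Cz CD cC] Cy] phiy]] := pphi.
(* The segment from (z, w) to (z, 0) lies in the domain, and D embeds in it as
   the subspace w = 0. *)
pose seg := (fun t : R => row_mx z (t%:C *: w)) @` `[0, 1].
pose base := (fun xi : Cspace R n => row_mx xi 0 : Cspace R (n + m)) @` C.
have csegt : connected seg.
  apply: connected_continuous_connected; first exact: segment_connected.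
  apply: continuous_subspaceT => t U /nearP [e e0 eP].
  have w1 : 0 < nrm w + 1 by rewrite ltr_wpDl ?nrm_ge0.
  apply/nbhs_ballP; exists (e / (nrm w + 1)); first by rewrite /= divr_gt0.
  move=> t'; rewrite /ball /= ltr_pdivlMr // => tt'; apply: eP.
  rewrite opp_row_mx add_row_mx subrr nrm_row_mx nrm0 -scalerBl -rmorphB nrmZ.
  rewrite normc_real distrC gt_max e0 /=; apply: le_lt_trans tt'.
  by rewrite mulrDr mulr1 lerDl.
have cbase : connected base.
  apply: connected_continuous_connected => //; apply: continuous_subspaceT => xi.
  move=> U /nearP [e e0 eP]; apply/nearP; exists e => // xi' h; apply: eP.
  by rewrite opp_row_mx add_row_mx subrr nrm_row_mx nrm0 gt_max h e0.
exists (row_mx y 0); last by rewrite polydisc_sup_restrict.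
exists (seg `|` base); last by right; exists y.
split.
- by left; exists 1; rewrite /= ?in_itv /= ?ler01 ?lexx // scale1r hsubmxK.
- move=> _ [[t /= + <-]|[xi /CD Dxi <-]]; last exact: polydisc_domain_restrict.
  rewrite in_itv /= => /andP[t0 t1] xi; rewrite row_mxKl row_mxKr nrmZ normc_real.
  rewrite ger0_norm // => h; apply: Dx; apply: le_trans h _.
  by rewrite ler_piMl ?nrm_ge0.
apply: connectedU => //; exists (row_mx z 0); split; last by exists z.
by exists 0; rewrite /= ?in_itv /= ?lexx ?ler01 // scale0r.
Qed.

End extension.

(** * Lelong numbers *)

Section lelong.
Context {R : realType}.

(** The constants over which the supremum defining the Lelong number is taken. *)
Definition log_bounded N (psi : Cspace R N -> \bar R) (x : Cspace R N) (c : R) :=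
  exists M : R, \forall y \near x^', (psi y <= (c * ln (enorm (y - x)) + M)%:E)%E.

Lemma near_puncturedP N (x : Cspace R N) (P : Cspace R N -> Prop) :
  (\forall y \near x^', P y) <->
  exists2 d : R, 0 < d & forall y, 0 < nrm (y - x) < d -> P y.
Proof.
rewrite /dnbhs near_withinE; split=> [/nearP [d d0 dP]|[d d0 dP]].
  exists d => // y /andP[y0 yd]; apply: dP => //.
  by move: y0; rewrite nrm_gt0 subr_eq0.
apply/nearP; exists d => // y yd yx; apply: dP.
by rewrite yd andbT nrm_gt0 subr_eq0.
Qed.

Lemma ler_ln_pos (x y : R) : 0 < x -> x <= y -> ln x <= ln y.
Proof. by move=> x0 xy; rewrite ler_ln ?posrE // (lt_le_trans x0). Qed.

(** At the centre itself the bound comes from the mean value inequality on a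
    disc of radius rho. *)
Lemma log_bounded_polydisc N (U : set (Cspace R N)) u z (c : R) : (0 < N)%N ->
  open U -> U z -> psh U u -> 0 <= c -> log_bounded u z c ->
  exists M, exists2 d : R, 0 < d & forall rho xi, 0 < rho < d ->
    nrm (xi - z) <= rho -> (u xi <= (c * ln rho + M)%:E)%E.
Proof.
move=> N0 oU Uz pu c0 [M /near_puncturedP [d d0 dP]].
have /nearP [d' d'0 d'U] : nbhs z U by exact: oU.
pose M' := c * ln N%:R + M.
have off rho xi : 0 < rho < d -> nrm (xi - z) <= rho -> xi != z ->
    (u xi <= (c * ln rho + M')%:E)%E.
  move=> /andP[rho0 rhod] xir xiz.
  have xi0 : 0 < nrm (xi - z) by rewrite nrm_gt0 subr_eq0.
  apply: le_trans (dP xi _) _; first by rewrite xi0 (le_lt_trans xir).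
  rewrite lee_fin /M' addrA lerD2r -mulrDr ler_wpM2l // -lnM ?posrE ?ltr0n //.
  apply: ler_ln_pos; first exact: lt_le_trans xi0 (enorm_ge_nrm _).
  apply: le_trans (enorm_le_nrm _) _.
  by rewrite mulrC ler_wpM2r.
exists M', (Num.min d d'); first by rewrite lt_min d0.
move=> rho xi; rewrite lt_min => /and3P[rho0 rhod rhod'] xir.
have [->|xiz] := eqVneq xi z; last by apply: off => //; rewrite rho0.
pose b : Cspace R N := const_mx rho%:C.
have nb : nrm b = rho.
  have [j ->] := nrm_attained b N0.
  by rewrite mxE normc_real ger0_norm // ltW.
have := @psh_submean R N U u z b pu.
have zb zeta : nrm (z + zeta *: b - z) = normc zeta * rho.
  by rewrite addrAC subrr add0r nrmZ nb.
move=> /(_ _) /le_trans; apply.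
  move=> zeta z1; apply: d'U; rewrite zb; apply: le_lt_trans rhod'.
  by rewrite ler_piMl // ltW.
rewrite -[leRHS]circle_mean_cst; apply: circle_mean_mono => t.
have nt : nrm (z + cis t *: b - z) = rho by rewrite zb normc_cis mul1r.
apply: off; rewrite ?rho0 ?nt //.
by rewrite -subr_eq0 -nrm_gt0 nt.
Qed.

Lemma enorm_row_mx0 n m (x : Cspace R n) :
  enorm (row_mx x 0 : Cspace R (n + m)) = enorm x.
Proof.
rewrite /enorm big_split_ord /= [X in _ + X]big1 ?addr0.
  by congr Num.sqrt; apply: eq_bigr => i _; rewrite row_mxEl.
by move=> i _; rewrite row_mxEr mxE normc0 expr0n.
Qed.

(** A point at distance rho from (z, 0) has its polydisc inside the polydisc of
    radius 2 rho about z. *)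
Lemma log_bounded_polydisc_sup n m (D : set (Cspace R n)) phi z (c : R) :
  (0 < n)%N -> open D -> D z -> psh D phi -> 0 <= c ->
  log_bounded (@polydisc_sup R n m phi) (row_mx z 0) c <-> log_bounded phi z c.
Proof.
move=> n0 oD Dz pphi c0; split.
  move=> [M /near_puncturedP [d d0 dP]]; exists M; apply/near_puncturedP.
  exists d => // y yd; rewrite -(@polydisc_sup_restrict R n m).
  have E : (row_mx y 0 : Cspace R (n + m)) - row_mx z 0 = row_mx (y - z) 0.
    by rewrite opp_row_mx add_row_mx subrr.
  have := dP (row_mx y 0); rewrite E enorm_row_mx0; apply.
  by rewrite nrm_row_mx nrm0 (max_idPl _) ?nrm_ge0.
move=> /(log_bounded_polydisc n0 oD Dz pphi c0) [M [d d0 dP]].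
exists (c * ln 2 + M); apply/near_puncturedP; exists (d / 2); first by rewrite divr_gt0.
move=> x /andP[x0 xd]; set rho := nrm (x - row_mx z 0) in x0 xd.
have E : x - row_mx z 0 = row_mx (lsubmx x - z) (rsubmx x).
  by rewrite -{1}(hsubmxK x) opp_row_mx add_row_mx subr0.
have lx : nrm (lsubmx x - z) <= rho by rewrite /rho E nrm_row_mx le_max lexx.
have rx : nrm (rsubmx x) <= rho by rewrite /rho E nrm_row_mx le_max lexx orbT.
apply: polydisc_sup_le => xi hxi.
apply: le_trans (dP (2 * rho) xi _ _) _.
- by apply/andP; split; lra.
- by apply: le_trans (nrm_dist_triangle _ (lsubmx x) _) _; lra.
have ln_le : c * ln rho <= c * ln (enorm (x - row_mx z 0)).
  by rewrite ler_wpM2l // ler_ln_pos // enorm_ge_nrm.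
rewrite lee_fin lnM ?posrE // mulrDr.
by move: ln_le; lra.
Qed.

Lemma lelong_polydisc_sup n m (D : set (Cspace R n)) phi z :
  (0 < n)%N -> open D -> D z -> psh D phi ->
  lelong (@polydisc_sup R n m phi) (row_mx z 0) = lelong phi z.
Proof.
move=> n0 oD Dz pphi; congr ereal_sup; congr image.
by apply/seteqP; split=> c /= [c0 h]; split=> //;
  apply/(log_bounded_polydisc_sup m n0 oD Dz pphi c0).
Qed.

Lemma lelong_ge0 n (D : set (Cspace R n)) phi z : (0 < n)%N ->
  open D -> D z -> psh D phi -> (0 <= lelong phi z)%E.
Proof.
move=> n0 oD Dz pphi; apply: ereal_sup_ubound; exists 0 => //; split=> //.
have [a za] : exists a : R, (phi z < a%:E)%E.
  have := psh_lty pphi Dz; case: (phi z) => [p||] // _.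
    by exists (p + 1); rewrite lte_fin ltrDl.
  by exists 0; rewrite ltNyr.
exists a; have /nearP [d d0 dP] := psh_usc pphi Dz za.
apply/near_puncturedP; exists d => // y /andP[_ /dP/ltW].
by rewrite mul0r add0r.
Qed.

(** Let B bound phi on the polydisc of radius R0 about z.  If phi stayed below
    c log r + C on the polydisc of radius r about y, where C is such that
    B = c log (R0 / 2) + C, then by the three circles inequality it would stay
    below c log rho + C on all the intermediate polydiscs about y.  But c is not
    admissible for z, so that this fails for a radius rho = 2 |xi - z| fixed in
    advance and every y close to z. *)
Lemma polydisc_lower_bound n (D : set (Cspace R n)) phi z (c : R) :
  open D -> D z -> psh D phi -> 0 <= c -> ~ log_bounded phi z c ->
  exists C, exists2 d : R, 0 < d & forall y r, nrm (y - z) < d -> 0 < r < d ->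
    exists2 xi, nrm (xi - y) <= r & ((c * ln r + C)%:E < phi xi)%E.
Proof.
move=> oD Dz pphi c0 nlb.
have /nearP [R1 R10 R1D] : nbhs z D by exact: oD.
pose R0 := R1 / 2; have R00 : 0 < R0 by rewrite divr_gt0.
have R0D xi : nrm (xi - z) <= R0 -> D xi.
  move=> h; apply: R1D; apply: le_lt_trans h _.
  by rewrite ltr_pdivrMr // ltr_pMr // ltr1n.
have [B hB] := psh_bounded_polydisc pphi (ltW R00) R0D.
pose C := B - c * ln (R0 / 2).
have [xi [xi0 xiR hxi]] : exists xi, [/\ 0 < nrm (xi - z), nrm (xi - z) < R0 / 8 &
    ((c * ln (enorm (xi - z)) + (C + c * ln 2))%:E < phi xi)%E].
  apply: contrapT => noxi; apply: nlb; exists (C + c * ln 2).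
  apply/near_puncturedP; exists (R0 / 8); first by rewrite divr_gt0.
  move=> xi /andP[h1 h2]; rewrite leNgt; apply/negP => h3.
  by apply: noxi; exists xi; split.
pose d := nrm (xi - z); exists C, d => // y r yz /andP[r0 rd].
apply: contrapT => noxi.
have below xi' : nrm (xi' - y) <= r -> (phi xi' <= (c * ln r + C)%:E)%E.
  by move=> h; rewrite leNgt; apply/negP => h'; apply: noxi; exists xi'.
have yR xi' : nrm (xi' - y) <= R0 / 2 -> nrm (xi' - z) <= R0.
  move=> h; apply: le_trans (nrm_dist_triangle _ y _) _; rewrite -/d in xiR; lra.
have on_bound xi' : nrm (xi' - y) = r \/ nrm (xi' - y) = R0 / 2 ->
    (phi xi' <= (c * ln (nrm (xi' - y)) + C)%:E)%E.
  case=> E; first by rewrite E; apply: below; rewrite E.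
  by rewrite E /C addrC subrK; apply: hB; apply: yR; rewrite E.
have xiy : nrm (xi - y) < 2 * d.
  by have := nrm_dist_triangle xi z y; rewrite (nrm_sub z) -/d; lra.
have : (phi xi <= (c * ln (2 * d) + C)%:E)%E.
  have [h|h] := leP (nrm (xi - y)) r.
    apply: le_trans (below _ h) _; rewrite lee_fin lerD2r ler_wpM2l //.
    by apply: ler_ln_pos => //; lra.
  apply: le_trans (psh_three_circles pphi r0 c0 (fun _ h => R0D _ (yR _ h)) on_bound _) _.
    by rewrite (ltW h) /= ltW // (lt_trans xiy) //; rewrite -/d in xiR; lra.
  rewrite lee_fin lerD2r ler_wpM2l // ler_ln_pos // ?(ltW xiy) //.
  exact: lt_trans h.
apply/negP; rewrite -ltNge; apply: le_lt_trans hxi; rewrite lee_fin.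
have ln_le : c * ln d <= c * ln (enorm (xi - z)).
  by rewrite ler_wpM2l // ler_ln_pos // enorm_ge_nrm.
rewrite lnM ?posrE // mulrDr.
by move: ln_le; lra.
Qed.

End lelong.

(** * Lebesgue measure on complex space *)

Section tuple_boxes.
Context d (T : measurableType d) (R : realType).
Variable mu : {sigma_finite_measure set T -> \bar R}.

Lemma measurable_tuple_box N (A : 'I_N -> set T) :
  (forall i, measurable (A i)) ->
  measurable [set t : N.-tuple T | forall i, A i (tnth t i)].
Proof.
move=> mA; rewrite (_ : mkset _ = \bigcap_(i in setT) ((@tnth N T)^~ i @^-1` A i)).
  apply: fin_bigcap_measurable => // i _; rewrite -[X in measurable X]setTI.
  exact: measurable_tnth.
by apply/seteqP; split=> t /= h i; [move=> _|]; exact: h.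
Qed.

Lemma tuple_measure_box N (A : 'I_N -> set T) (a : 'I_N -> R) :
  (forall i, measurable (A i)) -> (forall i, mu (A i) = (a i)%:E) ->
  tuple_measure mu N [set t : N.-tuple T | forall i, A i (tnth t i)]
  = (\prod_(i < N) a i)%:E.
Proof.
elim: N A a => [|N IH] A a mA muA.
  rewrite big_ord0 /= diracE mem_set //; by case.
rewrite big_ord_recl EFinM -muA -(IH (fun i => A (lift ord0 i))) //.
rewrite /= /pushforward -product_measure1E //; last first.
  by apply: (@measurable_tuple_box N (fun i => A (lift ord0 i))) => i.
congr (_ _); apply/seteqP; split=> [[x t] /= h|[x t] /= [h0 h] i].
  split=> [|i]; first by have := h ord0; rewrite tnth0.
  by have := h (lift ord0 i); rewrite tnthS.
case: (unliftP ord0 i) => [j|] ->; last by rewrite tnth0.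
by rewrite tnthS.
Qed.

End tuple_boxes.

Section complex_boxes.
Context {R : realType}.

Definition square (x : R[i]) (l : R) : set (plane R) :=
  `[complex.Re x, complex.Re x + l] `*` `[complex.Im x, complex.Im x + l].

Definition box N (x : Cspace R N) (l : 'I_N -> R) : set (N.-tuple (plane R)) :=
  [set t | forall i, square (x 0 i) (l i) (tnth t i)].

Lemma measurable_square x l : measurable (square x l).
Proof. by apply: measurableX; exact: measurable_itv. Qed.

Lemma measurable_box N (x : Cspace R N) l : measurable (box x l).
Proof.
apply: (measurable_tuple_box (A := fun i => square (x 0 i) (l i))) => i.
exact: measurable_square.
Qed.

Lemma Clebesgue_box N (x : Cspace R N) (l : 'I_N -> R) : (forall i, 0 <= l i) ->
  Clebesgue (box x l) = (\prod_(i < N) l i ^+ 2)%:E.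
Proof.
move=> l0.
apply: (tuple_measure_box (A := fun i => square (x 0 i) (l i))) => i.
  exact: measurable_square.
transitivity ((@lebesgue_measure R \x @lebesgue_measure R)%E (square (x 0 i) (l i))).
  by [].
rewrite /square product_measure1E; [|exact: measurable_itv..].
have side (a : R) : lebesgue_measure (`[a, a + l i]%classic : set R) = (l i)%:E.
  rewrite lebesgue_measure_itv /= lte_fin ltrDl -EFinB addrAC subrr add0r.
  by case: ltgtP (l0 i) => // <-.
transitivity ((l i)%:E * (l i)%:E)%E; last by rewrite -EFinM expr2.
by congr (_ * _)%E; exact: side.
Qed.

Lemma normc_coord_Cvec N (t t' : N.-tuple (plane R)) (e : R) : 0 < e ->
  (forall i, `|(tnth t i).1 - (tnth t' i).1| < e / 2 /\
             `|(tnth t i).2 - (tnth t' i).2| < e / 2) ->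
  nrm (Cvec t - Cvec t') <= e.
Proof.
move=> e0 h; apply/nrm_leP; split=> [|i]; first exact: ltW.
rewrite !mxE; apply: le_trans (normc_le_Re_Im _) _ => /=.
by have [h1 h2] := h i; rewrite [leRHS]splitr lerD // ltW.
Qed.

(** The products of open squares with rational centres and half-sides 1 / (k + 1)
    form a countable basis of the topology. *)
Lemma measurable_Cvec_open N (V : set (Cspace R N)) : open V ->
  measurable (@Cvec R N @^-1` V : set (N.-tuple (plane R))).
Proof.
move=> oV.
pose U := (N.-tuple (rat * rat) * nat)%type.
pose side (q : rat) (k : nat) : set (measurableTypeR R) :=
  [set x | `|x - ratr q| < k.+1%:R^-1].
pose S (u : U) i : set (plane R) :=
  side (tnth u.1 i).1 u.2 `*` side (tnth u.1 i).2 u.2.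
pose cell (u : U) : set (N.-tuple (plane R)) := [set t | forall i, S u i (tnth t i)].
have mside q k : measurable (side q k).
  rewrite (_ : side q k = `]ratr q - k.+1%:R^-1, ratr q + k.+1%:R^-1[%classic).
    exact: measurable_itv.
  by apply/seteqP; split=> x /=; rewrite /side in_itv /= ltr_distl.
have mcell u : measurable (cell u).
  apply: (measurable_tuple_box (A := S u)) => i.
  by apply: measurableX; exact: mside.
pose F (u : U) := if `[< cell u `<=` @Cvec R N @^-1` V >] then cell u else set0.
rewrite (_ : _ @^-1` _ = \bigcup_(u in setT) F u); last first.
  apply/seteqP; split=> [t /= Vt|t [u _]]; last first.
    by rewrite /F; case: asboolP => // h /h.
  have /nearP [d d0 dV] : nbhs (Cvec t) V by exact: oV.
  have [k kd] : exists k, k.+1%:R^-1 < d / 8.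
    by exists (Num.truncn (d / 8)^-1); rewrite invf_plt ?posrE ?divr_gt0 // truncnS_gt.
  have k0 : 0 < k.+1%:R^-1 :> R by rewrite invr_gt0.
  have approx (x : R) : exists q : rat, `|x - ratr q| < k.+1%:R^-1.
    have [q] := @rat_in_itvoo R (x - k.+1%:R^-1) (x + k.+1%:R^-1)
      ltac:(by rewrite ltrD2l gtrN).
    by rewrite in_itv /= => /andP[h1 h2]; exists q; rewrite distrC ltr_distl h1.
  have [q hq] := choice approx.
  pose c := [tuple (q (tnth t i).1, q (tnth t i).2) | i < N].
  exists (c, k) => //; have tc : cell (c, k) t.
    by move=> i; rewrite /S /= /c !tnth_mktuple; split; exact: hq.
  rewrite /F; case: asboolP => //; case=> t' t'c; apply: dV.
  apply: (@le_lt_trans _ _ (d / 2)); last by rewrite ltr_pdivrMr // ltr_pMr // ltr1n.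
  apply: normc_coord_Cvec => [|i]; first by rewrite divr_gt0.
  have near_cell (e p q' p' : R) : e < d / 8 ->
      `|p - q'| < e -> `|p' - q'| < e -> `|p' - p| < d / 2 / 2.
    move=> ed h1 h2; have := ler_distD q' p' p; rewrite (distrC q'); lra.
  have [h1 h2] := tc i; have [h3 h4] := t'c i.
  by split; [exact: near_cell kd h1 h3|exact: near_cell kd h2 h4].
apply: countable_bigcupT_measurable => [|u]; first exact: countableP.
by rewrite /F; case: asboolP.
Qed.

Lemma measurable_Cvec_usc N (V : set (Cspace R N)) (g : Cspace R N -> \bar R) :
  open V ->
  (forall x, V x -> forall a : R, (g x < a%:E)%E -> \forall y \near x, (g y < a%:E)%E) ->
  measurable_fun (@Cvec R N @^-1` V : set (N.-tuple (plane R)))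
    (fun t : N.-tuple (plane R) => g (Cvec t)).
Proof.
move=> oV usc mV; apply: (measurability _ (ErealGenInftyO.measurableE R)) => //.
move=> _ [_ [a ->] <-].
rewrite (_ : _ `&` _ = @Cvec R N @^-1` [set x | V x /\ (g x < a%:E)%E]).
  apply: measurable_Cvec_open; rewrite openE => x /= [Vx gx].
  have h1 : \forall y \near x, V y by exact: oV.
  exact: (filterI h1 (usc x Vx a gx)).
by apply/seteqP; split=> t /=; rewrite in_itv.
Qed.

Lemma measurable_expeR : measurable_fun setT (@expeR R).
Proof.
move=> mT; apply: (measurability _ (ErealGenInftyO.measurableE R)) => //.
move=> _ [_ [a ->] <-]; rewrite setTI.
have [a0|a0] := leP a 0.
  rewrite (_ : _ @^-1` _ = set0) //; rewrite -subset0 => x /=.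
  by rewrite in_itv /= => /lt_le_trans => /(_ 0%E); rewrite lee_fin a0 => /(_ isT);
    rewrite ltNge expeR_ge0.
rewrite (_ : _ @^-1` _ = [set` `]-oo, (ln a)%:E[%O ]); first exact: emeasurable_itv.
apply/seteqP; split=> x /=; rewrite !in_itv /=.
  by move=> h; rewrite -lte_expeR /= lnK ?posrE.
by rewrite -lte_expeR /= lnK ?posrE.
Qed.

End complex_boxes.

(** * Integrability of exponentials *)

Section integrability.
Context {R : realType}.

(** [box] has its corner at the given point, [cbox] its centre. *)
Definition cbox N (x : Cspace R N) (l : 'I_N -> R) : set (N.-tuple (plane R)) :=
  box (\row_i (x 0 i - (l i / 2 +i* (l i / 2))) : Cspace R N) l.

Lemma mem_cbox N (x : Cspace R N) (l : 'I_N -> R) (t : N.-tuple (plane R)) :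
  (forall i, normc (Cvec t 0 i - x 0 i) <= l i / 2) -> cbox x l t.
Proof.
move=> h i; have := le_trans (Re_le_normc _) (h i).
have := le_trans (Im_le_normc _) (h i); rewrite !mxE.
case: (x 0 i) (tnth t i) => a b [p q] /=.
rewrite !ler_norml => /andP[h1 h2] /andP[h3 h4].
by split; rewrite /= in_itv /=; apply/andP; split; lra.
Qed.

Definition product_sides n m (delta r : R) (i : 'I_(n + m)) : R :=
  if (i < n)%N then 2 * delta else 2 * r.

Lemma Clebesgue_cbox_product n m (x : Cspace R (n + m)) (delta r : R) :
  0 <= delta -> 0 <= r ->
  Clebesgue (cbox x (@product_sides n m delta r)) =
  (((2 * delta) ^+ 2) ^+ n * ((2 * r) ^+ 2) ^+ m)%:E.
Proof.
move=> d0 r0; rewrite Clebesgue_box; last first.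
  by move=> i; rewrite /product_sides; case: ifP; rewrite mulr_ge0.
rewrite big_split_ord /=; congr (_ * _)%:E.
  under eq_bigr => i _ do rewrite /product_sides /= ltn_ord.
  by rewrite prodr_const card_ord.
under eq_bigr => i _ do rewrite /product_sides /= ltnNge leq_addr /=.
by rewrite prodr_const card_ord.
Qed.

Lemma mem_cbox_product n m (x : Cspace R (n + m)) (delta r : R)
    (t : (n + m).-tuple (plane R)) :
  nrm (Cvec t - x) <= delta -> nrm (rsubmx (Cvec t - x)) <= r ->
  cbox x (@product_sides n m delta r) t.
Proof.
move=> h1 h2; apply: mem_cbox => i; rewrite /product_sides.
case: (split_ordP i) => j ->; rewrite /= ?ltn_ord ?(ltnNge (n + j)) ?leq_addr /=.
  rewrite mulrC mulKf //; apply: le_trans h1.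
  by have := nrm_coord (Cvec t - x) (lshift m j); rewrite !mxE.
rewrite mulrC mulKf //; apply: le_trans h2.
by have := nrm_coord (rsubmx (Cvec t - x)) j; rewrite !mxE.
Qed.

Lemma holo_germP N (x : Cspace R N) (f : Cspace R N -> (R[i])^o) : holo_germ x f ->
  exists2 d : R, 0 < d & forall y, nrm (y - x) < d -> {for y, continuous f}.
Proof.
move=> /nearP [d d0 dP]; exists d => // y /dP.
exact: differentiable_continuous.
Qed.

Lemma continuous_normc_sqr N (f : Cspace R N -> (R[i])^o) (x : Cspace R N) (a : R) :
  {for x, continuous f} -> normc (f x) ^+ 2 < a ->
  \forall y \near x, normc (f y) ^+ 2 < a.
Proof.
move=> cf fa.
have cg : {for x, continuous (fun y => normc (f y) ^+ 2)}.
  apply: (@continuous_comp _ _ _ (fun y => normc (f y)) (fun r : R => r ^+ 2)).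
    apply: (@continuous_comp _ _ _ f (fun y : (R[i])^o => normc y)) => //.
    exact: continuous_normc.
  exact: exprn_continuous.
exact: (@cvgr_lt _ _ (nbhs x) (nbhs_filter x) _ _ cg).
Qed.

(** The integrand in the definition of the multiplier ideal. *)
Definition weighted N (f : Cspace R N -> (R[i])^o) (psi : Cspace R N -> \bar R)
    (t : N.-tuple (plane R)) : \bar R :=
  ((Normc.normc (f (Cvec t)) ^+ 2)%:E * expeR (- (2%:E * psi (Cvec t))))%E.

Lemma weighted_ge0 N f psi (t : N.-tuple (plane R)) : (0 <= weighted f psi t)%E.
Proof. by rewrite mule_ge0 ?expeR_ge0 // lee_fin sqr_ge0. Qed.

Lemma measurable_weighted N (V : set (Cspace R N)) f psi : open V ->
  (forall x, V x -> {for x, continuous f}) ->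
  (forall x, V x -> forall a : R, (psi x < a%:E)%E ->
     \forall y \near x, (psi y < a%:E)%E) ->
  measurable_fun (@Cvec R N @^-1` V : set (N.-tuple (plane R))) (weighted f psi).
Proof.
move=> oV cf usc; apply: emeasurable_funM.
  apply: (measurable_Cvec_usc (g := fun y => (normc (f y) ^+ 2)%:E)) => // x Vx a.
  rewrite lte_fin => fa; have := continuous_normc_sqr (cf x Vx) fa.
  by apply: filterS => y; rewrite lte_fin.
apply: (measurableT_comp measurable_expeR); apply: measurableT_comp => //.
apply: emeasurable_funM; first exact: measurable_cst.
exact: measurable_Cvec_usc.
Qed.

Lemma open_nrm_ball N (x : Cspace R N) (d : R) : open [set y | nrm (y - x) < d].
Proof.
rewrite openE => y /= yd; apply/nearP; exists (d - nrm (y - x)); first by rewrite subr_gt0.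
by move=> y' h /=; apply: le_lt_trans (nrm_dist_triangle _ y _) _; lra.
Qed.

Lemma nneseries_geometric_lty (K q : R) : 0 <= K -> 0 < q < 1 ->
  (\sum_(0 <= j <oo) (K * q ^+ j)%:E < +oo)%E.
Proof.
move=> K0 /andP[q0 q1]; apply: (@le_lt_trans _ _ (K / (1 - q))%:E); last exact: ltry.
have t0 j : 0 <= K * q ^+ j by rewrite mulr_ge0 // exprn_ge0 // ltW.
apply: lime_le; first by apply: is_cvg_nneseries => j _ _; rewrite lee_fin.
near=> k; rewrite sumEFin lee_fin.
have := @geometric_seriesE R K q (negbT (lt_eqF q1)) => /(congr1 (fun h => h k)).
rewrite /series /geometric /= => ->.
rewrite ler_wpM2r ?invr_ge0 ?subr_ge0 ?(ltW q1) // ler_piMr // gerBl.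
by rewrite exprn_ge0 // ltW.
Unshelve. all: by end_near.
Qed.


(** On the shell e^(-j-1) delta <= |w| <= e^(-j) delta the weight is at most a
    constant times e^(2 beta j), while the polydisc |w| <= e^(-j) delta has
    volume of order e^(-2 m j): the integral is dominated by a geometric
    series.  The subspace w = 0 is negligible. *)
Lemma multiplier_ideal_log_pole n m (W : set (Cspace R (n + m))) psi
    (x : Cspace R (n + m)) (beta C d : R) f :
  (0 < m)%N -> rsubmx x = 0 -> open W -> W x ->
  (forall y, W y -> forall a : R, (psi y < a%:E)%E ->
     \forall y' \near y, (psi y' < a%:E)%E) ->
  0 <= beta < m%:R -> 0 < d ->
  (forall y r, nrm (y - x) < d -> 0 < r < d -> r <= nrm (rsubmx y) ->
     ((beta * ln r + C)%:E <= psi y)%E) ->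
  holo_germ x f -> multiplier_ideal psi x f.
Proof.
move=> m0 x0 oW Wx usc /andP[beta0 betam] d0 lower hf; split=> //.
have /nearP [d1 d10 d1W] : nbhs x W by exact: oW.
have [d2 d20 d2f] := holo_germP hf.
pose K := normc (f x) ^+ 2 + 1.
have K0 : 0 <= K by rewrite addr_ge0 // sqr_ge0.
have : normc (f x) ^+ 2 < K by rewrite ltrDl.
have fx : {for x, continuous f} by apply: d2f; rewrite subrr nrm0.
move=> /(continuous_normc_sqr fx) /nearP [d3 d30 d3f].
pose delta := Num.min (Num.min d d1) (Num.min d2 d3).
have delta0 : 0 < delta by rewrite !lt_min d0 d10 d20.
have [dd dd1 dd2 dd3] : [/\ delta <= d, delta <= d1, delta <= d2 & delta <= d3].
  by rewrite /delta !ge_min !lexx !orbT.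
pose V := [set y | nrm (y - x) < delta]; pose L := ln delta.
have oV : open V by exact: open_nrm_ball.
pose r (j : nat) := expR (L - j%:R).
have r0 j : 0 < r j by exact: expR_gt0.
have rdelta : r 0%N = delta by rewrite /r subr0 lnK.
pose a j := K * expR (- (2 * (beta * (L - j.+1%:R) + C))).
have a0 j : 0 <= a j by rewrite mulr_ge0 // expR_ge0.
pose B j := cbox x (@product_sides n m delta (r j)).
have mB j : measurable (B j) by exact: measurable_box.
pose DV := @Cvec R (n + m) @^-1` V : set ((n + m).-tuple (plane R)).
have mDV : measurable DV by exact: measurable_Cvec_open.
have mF : measurable_fun DV (weighted f psi).
  apply: (measurable_weighted oV) => y yV.
    by apply: d2f; exact: lt_le_trans yV dd2.
  by apply: usc; apply: d1W; exact: lt_le_trans yV dd1.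
exists V; split=> //; first by rewrite /V /= subrr nrm0.
apply/integrableP; split=> //.
under eq_integral do rewrite (gee0_abs (weighted_ge0 _ _ _)).
pose G (t : (n + m).-tuple (plane R)) : \bar R :=
  (\sum_(0 <= j <oo) (a j)%:E * (\1_(B j) t)%:E)%E.
have term0 j t : (0 <= (a j)%:E * (\1_(B j) t)%:E)%E.
  by rewrite mule_ge0 // lee_fin.
have mterm j : measurable_fun DV (fun t => (a j)%:E * (\1_(B j) t)%:E)%E.
  apply: emeasurable_funM; first exact: measurable_cst.
  by apply/measurable_EFinP; exact: measurable_indic.
have FG : (\int[Clebesgue (N := n + m)]_(t in DV) weighted f psi t <=
    \int[Clebesgue (N := n + m)]_(t in DV) G t)%E.
  apply: ae_ge0_le_integral => //.
  - by move=> t _; exact: weighted_ge0.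
  - by move=> t _; apply: nneseries_ge0 => j _ _; exact: term0.
  - exact: (ge0_emeasurable_sum (P := xpredT)).
  (* The subspace w = 0 lies in a box with sides of length 0. *)
  exists (cbox x (@product_sides n m delta 0)); split.
  - exact: measurable_box.
  - apply: etrans (Clebesgue_cbox_product x (ltW delta0) (lexx 0)) _.
    by rewrite mulr0 expr0n /= expr0n eqn0Ngt m0 mulr0.
  move=> t /= /not_implyP [tV tFG]; apply: mem_cbox_product; first exact: ltW.
  rewrite raddfB /= x0 subr0; rewrite leNgt; apply/negP => w0; apply: tFG.
  set y := Cvec t in tV w0 *.
  have wdelta : nrm (rsubmx y) < delta.
    apply: le_lt_trans tV; apply: le_trans (nrm_rsub (y - x)).
    by rewrite raddfB /= x0 subr0.
  have lnw : 0 <= L - ln (nrm (rsubmx y)).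
    by rewrite subr_ge0 ler_ln_pos // ltW.
  (* j is the index of the shell that contains w. *)
  have /andP [j1 j2] := truncn_itv lnw.
  set j := Num.truncn _ in j1 j2.
  have wr : nrm (rsubmx y) <= r j.
    by rewrite -(lnK (x := nrm _)) ?posrE // ler_expR; lra.
  have rw : r j.+1 <= nrm (rsubmx y).
    by rewrite -[leRHS]lnK ?posrE // ler_expR; lra.
  apply: (@le_trans _ _ ((a j)%:E * (\1_(B j) t)%:E)%E); last first.
    apply: le_trans (nneseries_lim_ge j.+1 (fun i _ _ => term0 i t)).
    by rewrite big_nat_recr //= leeDr // sume_ge0.
  rewrite indicE mem_set ?mule1; last first.
    apply: mem_cbox_product; first exact: ltW.
    by rewrite raddfB /= x0 subr0.
  have -> : (a j)%:E = (K%:E * (expR (- (2 * (beta * (L - j.+1%:R) + C))))%:E)%E.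
    by rewrite -EFinM.
  apply: lee_pmul.
  - by rewrite lee_fin sqr_ge0.
  - exact: expeR_ge0.
  - by rewrite lee_fin ltW // d3f // (lt_le_trans tV).
  rewrite -/(expeR (- (2 * (beta * (L - j.+1%:R) + C)))%:E) lee_expeR EFinN EFinM leeN2.
  rewrite lee_pmul2l //; have := lower y (r j.+1).
  rewrite expRK; apply=> //; first exact: lt_le_trans dd.
  by rewrite r0 (le_lt_trans rw) // (lt_le_trans wdelta).
apply: le_lt_trans FG _.
rewrite integral_nneseries //.
pose q := expR (2 * beta - 2 * m%:R).
pose K1 := K * expR (2 * beta - 2 * C - 2 * beta * L + 2 * m%:R * L) *
  ((2 * delta) ^+ 2) ^+ n * (2 ^+ 2) ^+ m.
have K10 : 0 <= K1.
  by rewrite /K1; apply: mulr_ge0; [apply: mulr_ge0; [apply: mulr_ge0|]|];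
    rewrite ?expR_ge0 ?exprn_ge0 ?mulr_ge0 // ltW.
have q01 : 0 < q < 1.
  by rewrite expR_gt0 -expR0 ltr_expR; lra.
apply: le_lt_trans (nneseries_geometric_lty K10 q01).
apply: lee_nneseries => [j _ _|j _].
  by apply: integral_ge0 => t _; exact: term0.
rewrite ge0_integralZl_EFin //; last first.
  by apply/measurable_EFinP; exact: measurable_indic.
rewrite integral_indic //.
apply: (@le_trans _ _ ((a j)%:E * Clebesgue (B j))%E).
  apply: lee_wpmul2l; first by rewrite lee_fin.
  apply: le_measure; rewrite ?inE //; first exact: measurableI.
rewrite (Clebesgue_cbox_product x (ltW delta0) (ltW (r0 j))) -EFinM lee_fin.
have expX k (y : R) : expR y ^+ k = expR (k%:R * y) by rewrite expRM_natl.
have -> : ((2 * r j) ^+ 2) ^+ m = (2 ^+ 2) ^+ m * expR (m%:R * (2 * (L - j%:R))).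
  by rewrite [(2 * r j) ^+ 2]exprMn [LHS]exprMn /r !expX.
rewrite /a /K1 /q expX.
have := expRD (m%:R * (2 * (L - j%:R))) (- (2 * (beta * (L - j.+1%:R) + C))).
have -> : m%:R * (2 * (L - j%:R)) + - (2 * (beta * (L - j.+1%:R) + C)) =
    (2 * beta - 2 * C - 2 * beta * L + 2 * m%:R * L) + j%:R * (2 * beta - 2 * m%:R).
  by rewrite -natr1; ring.
rewrite expRD; move: (expR _) (expR _) (expR _) (expR _) => e4 e3 e2 e1 E.
move: ((2 ^+ 2) ^+ m) (((2 * delta) ^+ 2) ^+ n) => c1 c2.
rewrite (_ : _ * (c2 * _) = K * c2 * c1 * (e3 * e4)); last by ring.
by rewrite -E (_ : _ * (e1 * e2) = K * e1 * c2 * c1 * e2) //; ring.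
Qed.

End integrability.

(** * Singularity exponents *)

Section exponents.
Context {R : realType}.

Lemma holo_germ1 N (x : Cspace R N) : holo_germ x (fun=> (1 : (R[i])^o)).
Proof. by apply: filterE => y; exact: differentiable_cst. Qed.

(** The boxes of side h at distance of order h from x, but not containing x,
    have volume h^(2N), and exp(-2 s psi) is at least of order h^(-2 s c) there;
    letting h tend to 0 shows that s c > N contradicts integrability. *)
Lemma log_bounded_exponent N (psi : Cspace R N -> \bar R) x (c s : R) : (0 < N)%N ->
  0 <= c -> log_bounded psi x c -> 0 < s ->
  multiplier_ideal (fun y => s%:E * psi y)%E x = holo_germ x -> s * c <= N%:R.
Proof.
move=> N0 c0 [M /near_puncturedP [d d0 dP]] s0 trivial_ideal.
have : multiplier_ideal (fun y => s%:E * psi y)%E x (fun=> 1).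
  by rewrite trivial_ideal; exact: holo_germ1.
move=> [_ [V [oV Vx intV]]].
have /nearP [d1 d10 d1V] : nbhs x V by exact: oV.
rewrite leNgt; apply/negP => sc.
have mDV := measurable_Cvec_open oV.
have := integrable_fin_num mDV intV; have := integrable_lty mDV intV.
set I := (\int[_]_(t in _) _)%E => Ilty /fineK.
move: (fine I) => i iE.
(* With side exp(-T), the integral over the box is at least
   exp(A + 2 (s c - N) T); T is so large that the box is inside the
   neighbourhoods at hand and that this exceeds the value i of the integral. *)
pose A := - (2 * s * (c * ln (N%:R * 4) + M)).
pose T := Num.max (- ln (Num.min d d1 / 8)) ((i - A) / (2 * (s * c - N%:R))).
pose e := expR (- T); have e0 : 0 < e by exact: expR_gt0.
have dd1 : 0 < Num.min d d1 by rewrite lt_min d0.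
have ed : 4 * e < Num.min d d1.
  have : e <= Num.min d d1 / 8.
    rewrite -[leRHS]lnK ?posrE ?divr_gt0 // /e ler_expR lerNl.
    by rewrite /T le_max lexx.
  by move: dd1; lra.
pose Q : set (N.-tuple (plane R)) :=
  box (\row_i (x 0 i + (e +i* e)) : Cspace R N) (fun=> e).
have mQ : measurable Q by exact: measurable_box.
have Qnrm t : Q t -> e <= nrm (Cvec t - x) <= 4 * e.
  move=> Qt.
  have coord i0 : e <= normc ((Cvec t - x) 0 i0) <= 4 * e.
    have := Re_le_normc ((Cvec t - x) 0 i0).
    have := normc_le_Re_Im ((Cvec t - x) 0 i0).
    have := Qt i0; rewrite !mxE; case: (x 0 i0) (tnth t i0) => a b [p q] [] /=.
    rewrite !in_itv /= => /andP[h1 h2] /andP[h3 h4].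
    have pa : 0 <= p - a by lra.
    have qb : 0 <= q - b by lra.
    rewrite (ger0_norm pa) (ger0_norm qb); move: (Num.sqrt _) => N1 h5 h6.
    by apply/andP; split; lra.
  have [j ->] := nrm_attained (Cvec t - x) N0; exact: coord.
pose k := expR (- (2 * (s * (c * ln (N%:R * (4 * e)) + M)))).
have : ((k * (e ^+ 2) ^+ N)%:E <= I)%E.
  have <- : (\int[Clebesgue (N := N)]_(t in @Cvec R N @^-1` V) (k%:E * (\1_Q t)%:E))%E
      = (k * (e ^+ 2) ^+ N)%:E.
    rewrite ge0_integralZl_EFin ?expR_ge0 //; last first.
      by apply/measurable_EFinP; exact: measurable_indic.
    rewrite integral_indic // (_ : Q `&` _ = Q).
      rewrite EFinM; congr (_ * _)%E.
      apply: etrans (Clebesgue_box _ (fun=> ltW e0)) _.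
      by rewrite prodr_const card_ord.
    apply/seteqP; split=> [t []//|t Qt]; split=> //; apply: d1V.
    have /andP[_ h] := Qnrm t Qt; apply: le_lt_trans h (lt_le_trans ed _).
    by rewrite ge_min lexx orbT.
  apply: integral_mono => t Vt; rewrite indicE.
  case: (asboolP (Q t)) => [Qt|nQt]; last first.
    rewrite memNset // mule0; exact: (weighted_ge0 (fun=> 1) (fun y => s%:E * psi y)%E t).
  rewrite mem_set // mule1 normc1 expr1n mul1e.
  have /andP[n1 n2] := Qnrm t Qt.
  rewrite -/(expeR (- (2 * (s * (c * ln (N%:R * (4 * e)) + M))))%:E) lee_expeR.
  rewrite EFinN EFinM leeN2 lee_pmul2l // EFinM lee_pmul2l //.
  apply: le_trans (dP (Cvec t) _) _.
    rewrite (lt_le_trans e0 n1) /=; apply: le_lt_trans n2 (lt_le_trans ed _).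
    by rewrite ge_min lexx.
  rewrite lee_fin lerD2r ler_wpM2l // ler_ln_pos //.
    exact: lt_le_trans e0 (le_trans n1 (enorm_ge_nrm _)).
  by apply: le_trans (enorm_le_nrm _) _; rewrite ler_wpM2l.
rewrite -iE lee_fin; apply/negP; rewrite -ltNge.
have -> : k * (e ^+ 2) ^+ N = expR (A + 2 * (s * c - N%:R) * T).
  have expX m (y : R) : expR y ^+ m = expR (m%:R * y) by rewrite expRM_natl.
  have lnE : ln (N%:R * (4 * e)) = ln (N%:R * 4) - T.
    by rewrite mulrA lnM ?posrE ?mulr_gt0 ?ltr0n // expRK.
  rewrite /k lnE /e !expX -expRD; congr expR; rewrite /A; ring.
apply: lt_le_trans (expR_ge1Dx _).
have : i - A <= 2 * (s * c - N%:R) * T.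
  rewrite mulrC -ler_pdivrMr; first by rewrite /T le_max lexx orbT.
  by rewrite mulr_gt0 // subr_gt0.
lra.
Qed.

Lemma sing_exponent_le N (psi : Cspace R N -> \bar R) x : (0 < N)%N ->
  (0 <= lelong psi x)%E -> (sing_exponent psi x <= (N%:R)%:E / lelong psi x)%E.
Proof.
move=> N0 nu0; apply: ge_ereal_sup => _ [s [s0 sI] <-].
have [->|sn0] := eqVneq s 0; first by rewrite mule_ge0 // inve_ge0.
have {sn0}s0 : 0 < s by rewrite lt_neqAle eq_sym sn0.
have : (lelong psi x <= (N%:R / s)%:E)%E.
  apply: ge_ereal_sup => _ [c [c0 cb] <-]; rewrite lee_fin ler_pdivlMr // mulrC.
  exact: log_bounded_exponent cb s0 sI.
case: (lelong psi x) nu0 => [v| |] //; rewrite !lee_fin => v0 vs.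
rewrite inver; case: eqVneq => [_|vn0].
  by rewrite gt0_muley ?leey // lte_fin ltr0n.
have {}v0 : 0 < v by rewrite lt_neqAle eq_sym vn0.
by rewrite -EFinM lee_fin ler_pdivlMr // mulrC -ler_pdivlMr.
Qed.

Section extension_exponent.
Variables (n m : nat) (D : set (Cspace R n)) (phi : Cspace R n -> \bar R).
Hypotheses (n0 : (0 < n)%N) (m0 : (0 < m)%N) (oD : open D) (pphi : psh D phi).
Variable z : Cspace R n.
Hypothesis Dz : D z.

Local Notation x := (row_mx z 0 : Cspace R (n + m)).
Local Notation Phi := (@polydisc_sup R n m phi).

Lemma scaled_usc (s : R) y : 0 <= s -> polydisc_domain D y ->
  forall a : R, (s%:E * Phi y < a%:E)%E -> \forall y' \near y, (s%:E * Phi y' < a%:E)%E.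
Proof.
rewrite le_eqVlt => /orP[/eqP <-|s0] Dy a.
  by rewrite mul0e => a0; apply: filterE => y'; rewrite mul0e.
rewrite -lte_pdivlMl // -EFinM => h.
have := psh_usc (psh_polydisc_sup m0 oD pphi) Dy h.
by apply: filterS => y'; rewrite EFinM lte_pdivlMl.
Qed.

(** The case s = 0 is the one that remains when the Lelong number is infinite. *)
Lemma exponent_admissible (s c : R) : 0 <= s -> 0 <= c -> s * c < m%:R ->
  s = 0 \/ ~ log_bounded phi z c ->
  multiplier_ideal (fun y => s%:E * Phi y)%E x = holo_germ x.
Proof.
move=> s0 c0 sc h; apply/seteqP; split=> [f []//|f hf].
have xr : rsubmx x = 0 by rewrite row_mxKr.
have oW := open_polydisc_domain (m := m) oD.
have Wx := polydisc_domain_restrict (m := m) Dz.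
have usc y (Dy : polydisc_domain D y) := scaled_usc s0 Dy.
have scb : 0 <= s * c < m%:R by rewrite mulr_ge0.
case: h => [sE|nlb].
  apply: (@multiplier_ideal_log_pole R n m _ _ x (s * c) 0 1 f m0 xr oW Wx usc scb) => //.
  by move=> y r _ _ _; rewrite sE !mul0r mul0e addr0.
have [C [d d0 dP]] := polydisc_lower_bound oD Dz pphi c0 nlb.
apply: (@multiplier_ideal_log_pole R n m _ _ x (s * c) (s * C) d f
  m0 xr oW Wx usc scb) => //.
move=> y r yd rd ry; have [|xi xir hxi] := dP (lsubmx y) r _ rd.
  apply: le_lt_trans yd; have := nrm_lsub (y - x).
  by rewrite raddfB /= row_mxKl.
rewrite -mulrA -mulrDr EFinM; apply: lee_wpmul2l; first by rewrite lee_fin.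
by apply: le_trans (ltW hxi) (le_polydisc_sup _ _); exact: le_trans xir ry.
Qed.

Lemma sing_exponent_ge :
  ((m%:R)%:E / lelong phi z <= sing_exponent Phi x)%E.
Proof.
have zero : (0 <= sing_exponent Phi x)%E.
  apply: ereal_sup_ubound; exists 0 => //; split=> //.
  by apply: (@exponent_admissible 0 0); rewrite ?mul0r ?ltr0n //; left.
have := lelong_ge0 n0 oD Dz pphi.
case nuE : (lelong phi z) => [v| |] //; last by rewrite invey mule0.
rewrite lee_fin => v0.
have below (s : R) : 0 <= s -> s * v < m%:R -> (s%:E <= sing_exponent Phi x)%E.
  rewrite le_eqVlt => /orP[/eqP <- //|s0] sv.
  (* Any c with v < c < m / s will do. *)
  pose c := v + (m%:R - s * v) / (2 * s).
  have vc : v < c by rewrite ltrDl divr_gt0 ?mulr_gt0 // subr_gt0.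
  apply: ereal_sup_ubound; exists s => //; split; first exact: ltW.
  apply: (@exponent_admissible s c); first exact: ltW.
  - exact: le_trans (ltW vc).
  - have -> : s * c = s * v + (m%:R - s * v) / 2.
      by rewrite /c; field; rewrite gt_eqF.
    lra.
  right=> lb; have : (c%:E <= lelong phi z)%E.
    by apply: ereal_sup_ubound; exists c => //; split=> //; exact: le_trans (ltW vc).
  by rewrite nuE lee_fin leNgt vc.
rewrite leNgt; apply/negP => lt.
have [q] : exists q : R, [/\ 0 <= q, (sing_exponent Phi x < q%:E)%E & q * v < m%:R].
  move: zero lt; case: (sing_exponent Phi x) => [p| |] //;
    last by move=> _; rewrite ltNge leey.
  rewrite lee_fin => p0.
  rewrite inver; case: eqVneq => [->|vn0].
    move=> _; exists (p + 1); rewrite mulr0 ltr0n addr_ge0 //.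
    by split=> //; rewrite lte_fin ltrDl.
  have {}v0 : 0 < v by rewrite lt_neqAle eq_sym vn0.
  rewrite -EFinM lte_fin => pm; exists ((p + m%:R / v) / 2).
  split; [|by rewrite lte_fin; lra|].
    by rewrite divr_ge0 // addr_ge0 // divr_ge0 // ltW.
  by rewrite -ltr_pdivlMr //; lra.
by case=> q0 lq qv; have := below q q0 qv; rewrite leNgt lq.
Qed.

End extension_exponent.

End exponents.

(** * The extension theorem *)

Theorem theorem1p3 (R : realType) (n : nat) (n_gt0 : (0 < n)%N)
    (D : set (Cspace R n)) (phi : Cspace R n -> \bar R) :
  open D -> compact (closure D) -> D 0 -> psh D phi ->
  forall k : nat, (0 < k)%N ->
  exists (Omega : set (Cspace R (n + (2 ^ k - 1) * n)))
         (phik : Cspace R (n + (2 ^ k - 1) * n) -> \bar R),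
    [/\ open Omega,
        forall z, D z -> Omega (row_mx z 0),
        psh Omega phik &
        forall z, D z ->
          [/\ phik (row_mx z 0) = phi z,
              lelong phik (row_mx z 0) = lelong phi z,
              ((((2 ^ k - 1) * n)%N%:R)%:E / lelong phi z
                <= sing_exponent phik (row_mx z 0))%E &
              (sing_exponent phik (row_mx z 0)
                <= ((2 ^ k * n)%N%:R)%:E / lelong phi z)%E]].
Proof.
move=> oD _ _ pphi k k_gt0.
have m_gt0 : (0 < (2 ^ k - 1) * n)%N.
  by rewrite muln_gt0 n_gt0 andbT subn_gt0 -{1}(expn0 2) ltn_exp2l.
exists (polydisc_domain D), (polydisc_sup phi); split.
- exact: open_polydisc_domain.
- by move=> z Dz; exact: polydisc_domain_restrict.
- exact: psh_polydisc_sup.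
move=> z Dz.
have nuE := lelong_polydisc_sup ((2 ^ k - 1) * n) n_gt0 oD Dz pphi.
split.
- exact: polydisc_sup_restrict.
- exact: nuE.
- exact: (sing_exponent_ge n_gt0 m_gt0 oD pphi Dz).
have dimE : (2 ^ k * n = n + (2 ^ k - 1) * n)%N.
  by rewrite -mulSn subn1 prednK ?expn_gt0.
rewrite dimE -nuE; apply: sing_exponent_le; first by rewrite addn_gt0 n_gt0.
by rewrite nuE; exact: (lelong_ge0 n_gt0 oD Dz pphi).
Qed.
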